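(* Let $\mathcal{C}$ be a Heyting pretopos with an (indexed) natural number object and a class $\mathcal{S}$ of small maps. Then the powerclass functor $\mathcal{P}_s$ on $\mathcal{C}$ has an (indexed) final coalgebra.
   Context: An (indexed) natural number object in $\mathcal{C}$ is an object $\mathbb{N}$ with maps $0:1\to\mathbb{N}$, $s:\mathbb{N}\to\mathbb{N}$ such that for any $f:P\to Y$ and $t:P\times Y\to Y$ there is a unique $\bar f:P\times\mathbb{N}\to Y$ with $\bar f\circ\langle \mathrm{id},0\rangle=f$ and $\bar f\circ(\mathrm{id}\times s)=t\circ\langle p_1,\bar f\rangle$. A class $\mathcal{S}$ of arrows of $\mathcal{C}$ is a class of small maps if it satisfies: (S1) $\mathcal{S}$ contains identities and is closed under composition; (S2) $\mathcal{S}$ is stable under pullback along arbitrary maps; (S3) every diagonal $\Delta_C:C\to C\times C$ is in $\mathcal{S}$; (S4) if $e:C\to D$ is epi, $g:D\to A$, and $ge\in\mathcal{S}$, then $g\in\mathcal{S}$; (S5) if $f:C\to A$ and $g:D\to A$ are in $\mathcal{S}$, so is $[f,g]:C+D\to A$; (P1) for every object $C$ there is an object $\mathcal{P}_s(C)$ and a natural (in $I$) bijection between maps $I\to\mathcal{P}_s(C)$ and small relations between $I$ and $C$, i.e. subobjects $R\rightarrowtail I\times C$ whose composite with the projection to $I$ is in $\mathcal{S}$; (I) $\mathbb{N}\to 1$ is in $\mathcal{S}$; (R) there is a universal small map $\pi:E\to U$ in $\mathcal{S}$: for every $f:A\to B$ in $\mathcal{S}$ there are an epi $q:B'\to B$ and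 a map $B'\to U$ such that the pullback of $f$ along $q$ is isomorphic over $B'$ to the pullback of $\pi$ along $B'\to U$. Arrows in $\mathcal{S}$ are called small. $C\mapsto\mathcal{P}_s(C)$ is a covariant functor: $\mathcal{P}_s(g)$ sends small subobjects to their images along $g$. The class $\mathcal{S}$ induces a class of small maps on every slice $\mathcal{C}/I$ (the morphisms of $\mathcal{C}/I$ whose underlying map is in $\mathcal{S}$), and the corresponding powerclass functors $\mathcal{P}_s^I$ on $\mathcal{C}/I$ make $\mathcal{P}_s$ the component over $1$ of an indexed endofunctor on the canonical indexing of $\mathcal{C}$. An indexed final coalgebra of $\mathcal{P}_s$ is a $\mathcal{P}_s$-coalgebra $(V,E)$ in $\mathcal{C}$ such that $I^*(V,E)$ is a terminal $\mathcal{P}_s^I$-coalgebra for every object $I$ of $\mathcal{C}$. *)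

(* Defs.v *)
From Corelib Require Import ssreflect ssrfun.
From Stdlib Require Import ProofIrrelevance IndefiniteDescription.

Set Implicit Arguments.
Unset Strict Implicit.
Unset Printing Implicit Defensive.

Declare Scope cat_scope.
Delimit Scope cat_scope with cat.
Local Open Scope cat_scope.

Record category := Category {
  ob :> Type;
  hom : ob -> ob -> Type;
  idm : forall A, hom A A;
  comp : forall A B D, hom B D -> hom A B -> hom A D;
  comp1m : forall A B (f : hom A B), comp (idm B) f = f;
  compm1 : forall A B (f : hom A B), comp f (idm A) = f;
  compA : forall A B D E (h : hom D E) (g : hom B D) (f : hom A B),
      comp h (comp g f) = comp (comp h g) f }.

Arguments hom {c} A B.
Arguments idm {c} A.
Arguments comp {c A B D} g f.
Arguments comp1m {c A B} f.
Arguments compm1 {c A B} f.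
Arguments compA {c A B D E} h g f.

Notation "g '\c' f" := (comp g f) (at level 40, left associativity) : cat_scope.

Definition arrow_class (C : category) := forall A B : C, hom A B -> Prop.

Definition in_class (C : category) (S : arrow_class C) (A B : C) (f : hom A B) :
  Prop := S A B f.

Definition mono (C : category) (A B : C) (m : hom A B) : Prop :=
  forall (Z : C) (f g : hom Z A), m \c f = m \c g -> f = g.

Definition epi (C : category) (A B : C) (e : hom A B) : Prop :=
  forall (Z : C) (f g : hom B Z), f \c e = g \c e -> f = g.

Definition iso (C : category) (A B : C) (f : hom A B) : Prop :=
  exists g : hom B A, g \c f = idm A /\ f \c g = idm B.

(* Extremal epimorphisms; [m] below is a subobject through which [e] factors. *)
Definition cover (C : category) (A B : C) (e : hom A B) : Prop :=
  forall (M : C) (m : hom M B) (e' : hom A M), mono m -> m \c e' = e -> iso m.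

(* [f] factors through [m]; for monos with the same codomain, this is the
   order on subobjects. *)
Definition factors (C : category) (A B D : C) (f : hom A D) (m : hom B D) : Prop :=
  exists h : hom A B, m \c h = f.

Definition is_initial (C : category) (Z : C) : Prop :=
  forall A : C, exists! f : hom Z A, True.

Definition is_coproduct (C : category) (A B S : C)
    (i : hom A S) (j : hom B S) : Prop :=
  forall (Z : C) (f : hom A Z) (g : hom B Z),
    exists! h : hom S Z, h \c i = f /\ h \c j = g.

Definition is_pullback (C : category) (A B D P : C) (f : hom A D) (g : hom B D)
    (p : hom P A) (q : hom P B) : Prop :=
  f \c p = g \c q /\
  forall (Z : C) (u : hom Z A) (v : hom Z B), f \c u = g \c v ->
    exists! w : hom Z P, p \c w = u /\ q \c w = v.

Record lex := Lex {
  lex_cat :> category;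
  one : lex_cat;
  bang : forall A : lex_cat, hom A one;
  bang_uniq : forall (A : lex_cat) (f g : hom A one), f = g;
  pb : forall A B D : lex_cat, hom A D -> hom B D -> lex_cat;
  pbl : forall (A B D : lex_cat) (f : hom A D) (g : hom B D), hom (pb f g) A;
  pbr : forall (A B D : lex_cat) (f : hom A D) (g : hom B D), hom (pb f g) B;
  pbC : forall (A B D : lex_cat) (f : hom A D) (g : hom B D),
      f \c pbl f g = g \c pbr f g;
  pb_pair : forall (A B D : lex_cat) (f : hom A D) (g : hom B D)
      (Z : lex_cat) (u : hom Z A) (v : hom Z B),
      f \c u = g \c v -> hom Z (pb f g);
  pb_pairl : forall (A B D : lex_cat) (f : hom A D) (g : hom B D)
      (Z : lex_cat) (u : hom Z A) (v : hom Z B) (e : f \c u = g \c v),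
      pbl f g \c pb_pair e = u;
  pb_pairr : forall (A B D : lex_cat) (f : hom A D) (g : hom B D)
      (Z : lex_cat) (u : hom Z A) (v : hom Z B) (e : f \c u = g \c v),
      pbr f g \c pb_pair e = v;
  pb_ext : forall (A B D : lex_cat) (f : hom A D) (g : hom B D)
      (Z : lex_cat) (h k : hom Z (pb f g)),
      pbl f g \c h = pbl f g \c k -> pbr f g \c h = pbr f g \c k -> h = k }.

Arguments one {l}.
Arguments bang {l} A.
Arguments pb {l A B D} f g.
Arguments pbl {l A B D} f g.
Arguments pbr {l A B D} f g.
Arguments pbC {l A B D} f g.
Arguments pb_pair {l A B D f g Z u v} e.

Section Lex.
Variable C : lex.

Definition prod (A B : C) : C := pb (bang A) (bang B).
Definition fst (A B : C) : hom (prod A B) A := pbl (bang A) (bang B).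
Definition snd (A B : C) : hom (prod A B) B := pbr (bang A) (bang B).
Definition pair (Z A B : C) (u : hom Z A) (v : hom Z B) : hom Z (prod A B) :=
  pb_pair (bang_uniq (bang A \c u) (bang B \c v)).
Definition prodmap (A A' B B' : C) (f : hom A A') (g : hom B B') :
    hom (prod A B) (prod A' B') :=
  pair (f \c fst A B) (g \c snd A B).
Definition diag (A : C) : hom A (prod A A) := pair (idm A) (idm A).

Lemma fst_pair (Z A B : C) (u : hom Z A) (v : hom Z B) : fst A B \c pair u v = u.
Proof. exact: pb_pairl. Qed.

Lemma snd_pair (Z A B : C) (u : hom Z A) (v : hom Z B) : snd A B \c pair u v = v.
Proof. exact: pb_pairr. Qed.

Lemma prod_ext (Z A B : C) (h k : hom Z (prod A B)) :
  fst A B \c h = fst A B \c k -> snd A B \c h = snd A B \c k -> h = k.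
Proof. exact: pb_ext. Qed.

Lemma fst_prodmap (A A' B B' : C) (f : hom A A') (g : hom B B') :
  fst A' B' \c prodmap f g = f \c fst A B.
Proof. exact: fst_pair. Qed.

Lemma snd_prodmap (A A' B B' : C) (f : hom A A') (g : hom B B') :
  snd A' B' \c prodmap f g = g \c snd A B.
Proof. exact: snd_pair. Qed.

Lemma pair_comp (Z Z' A B : C) (u : hom Z A) (v : hom Z B) (w : hom Z' Z) :
  pair u v \c w = pair (u \c w) (v \c w).
Proof. by apply: prod_ext; rewrite compA ?fst_pair ?snd_pair. Qed.

Lemma pb_is_pullback (A B D : C) (f : hom A D) (g : hom B D) :
  is_pullback f g (pbl f g) (pbr f g).
Proof.
split; first exact: pbC.
move=> Z u v e; exists (pb_pair e); split; first by rewrite pb_pairl pb_pairr.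
by move=> w [e1 e2]; apply: pb_ext; rewrite ?pb_pairl ?pb_pairr.
Qed.

Lemma is_pullback_sym (A B D P : C) (f : hom A D) (g : hom B D)
    (p : hom P A) (q : hom P B) : is_pullback f g p q -> is_pullback g f q p.
Proof.
move=> [e H]; split; first by [].
move=> Z u v e'; have [w [[e1 e2] Hw]] := H _ _ _ (esym e').
by exists w; split; [split | move=> w' [e3 e4]; apply: Hw].
Qed.

End Lex.

Record regular := Regular {
  reg_lex :> lex;
  im : forall A B : reg_lex, hom A B -> reg_lex;
  im_mono : forall (A B : reg_lex) (f : hom A B), hom (im f) B;
  im_cover : forall (A B : reg_lex) (f : hom A B), hom A (im f);
  im_fact : forall (A B : reg_lex) (f : hom A B), im_mono f \c im_cover f = f;
  im_monoP : forall (A B : reg_lex) (f : hom A B), mono (im_mono f);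
  im_coverP : forall (A B : reg_lex) (f : hom A B), cover (im_cover f);
  cover_stable : forall (A B D P : reg_lex) (f : hom A D) (g : hom B D)
      (p : hom P A) (q : hom P B), is_pullback f g p q -> cover f -> cover q }.

Arguments im {r A B} f.
Arguments im_mono {r A B} f.
Arguments im_cover {r A B} f.

Definition equivalence_relation (C : lex) (A R : C) (r1 r2 : hom R A) : Prop :=
  mono (pair r1 r2) /\
  (exists d : hom A R, r1 \c d = idm A /\ r2 \c d = idm A) /\
  (exists s : hom R R, r1 \c s = r2 /\ r2 \c s = r1) /\
  (exists t : hom (pb r2 r1) R,
      r1 \c t = r1 \c pbl r2 r1 /\ r2 \c t = r2 \c pbr r2 r1).

(* A Heyting pretopos is presented as an effective regular category with
   disjoint, pullback-stable finite coproducts in which every inverse image map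
   f^* : Sub(B) -> Sub(A) has a right adjoint ([forall_along]). *)
Record heyting_pretopos := HeytingPretopos {
  hp_reg :> regular;
  effective : forall (A R : hp_reg) (r1 r2 : hom R A),
      equivalence_relation r1 r2 ->
      exists (Q : hp_reg) (q : hom A Q), is_pullback q q r1 r2;
  zero : hp_reg;
  from_zero : forall A : hp_reg, hom zero A;
  from_zero_uniq : forall (A : hp_reg) (f g : hom zero A), f = g;
  sum : hp_reg -> hp_reg -> hp_reg;
  inl : forall A B : hp_reg, hom A (sum A B);
  inr : forall A B : hp_reg, hom B (sum A B);
  copair : forall A B Z : hp_reg, hom A Z -> hom B Z -> hom (sum A B) Z;
  copair_inl : forall (A B Z : hp_reg) (f : hom A Z) (g : hom B Z),
      copair f g \c inl A B = f;
  copair_inr : forall (A B Z : hp_reg) (f : hom A Z) (g : hom B Z),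
      copair f g \c inr A B = g;
  sum_ext : forall (A B Z : hp_reg) (h k : hom (sum A B) Z),
      h \c inl A B = k \c inl A B -> h \c inr A B = k \c inr A B -> h = k;
  inl_mono : forall A B : hp_reg, mono (inl A B);
  inr_mono : forall A B : hp_reg, mono (inr A B);
  sum_disjoint : forall A B : hp_reg,
      is_pullback (inl A B) (inr A B) (from_zero A) (from_zero B);
  zero_stable : forall (A B P : hp_reg) (f : hom A B) (p : hom P A)
      (q : hom P zero), is_pullback f (from_zero B) p q -> is_initial P;
  sum_stable : forall (A B Z P Q : hp_reg) (h : hom Z (sum A B))
      (p : hom P Z) (a : hom P A) (q : hom Q Z) (b : hom Q B),
      is_pullback h (inl A B) p a -> is_pullback h (inr A B) q b ->
      is_coproduct p q;
  forall_along : forall (A B M : hp_reg) (f : hom A B) (m : hom M A), mono m ->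
      exists (N : hp_reg) (n : hom N B), mono n /\
        forall (K : hp_reg) (k : hom K B), mono k ->
          (factors (pbl f k) m <-> factors k n) }.

Arguments copair {h A B Z} f g : rename.

Record nno (C : lex) := NNO {
  nat_ob :> C;
  nat_zero : hom one nat_ob;
  nat_succ : hom nat_ob nat_ob;
  nat_rec : forall (P Y : C) (f : hom P Y) (t : hom (prod P Y) Y),
      exists! fbar : hom (prod P nat_ob) Y,
        fbar \c pair (idm P) (nat_zero \c bang P) = f /\
        fbar \c prodmap (idm P) nat_succ = t \c pair (fst P nat_ob) fbar }.

Section Powerclass.
Variables (C : lex) (S : arrow_class C).

Record small_rel (I A : C) := SmallRel {
  rel_ob : C;
  rel_map : hom rel_ob (prod I A);
  rel_mono : mono rel_map;
  rel_small : in_class S (fst I A \c rel_map) }.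

(* Equality of small relations as subobjects of [prod I A]. *)
Definition rel_eq (I A : C) (R R' : small_rel I A) : Prop :=
  factors (rel_map R) (rel_map R') /\ factors (rel_map R') (rel_map R).

(* A natural bijection, for every object [A], between maps from [I] to [pow A]
   and small relations between [I] and [A] up to [rel_eq]; the naturality
   condition says that composition with [u] corresponds to pullback along
   [prodmap u (idm A)]. *)
Record powerclass := Powerclass {
  pow : C -> C;
  classify : forall I A : C, small_rel I A -> hom I (pow A);
  rel_of : forall I A : C, hom I (pow A) -> small_rel I A;
  classify_eq : forall (I A : C) (R R' : small_rel I A),
      rel_eq R R' -> classify R = classify R';
  classifyK : forall (I A : C) (R : small_rel I A), rel_eq (rel_of (classify R)) R;
  rel_ofK : forall (I A : C) (f : hom I (pow A)), classify (rel_of f) = f;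
  classify_nat : forall (I J A : C) (u : hom J I) (R : small_rel I A)
      (R' : small_rel J A) (k : hom (rel_ob R') (rel_ob R)),
      is_pullback (prodmap u (idm A)) (rel_map R) (rel_map R') k ->
      classify R' = classify R \c u }.

End Powerclass.

Arguments rel_of {C S p I A} f.
Arguments classify {C S} p {I A} R.

(* The membership relation on [A], which corresponds to [idm (pow P A)]. *)
Definition mem_rel (C : lex) (S : arrow_class C) (P : powerclass S) (A : C) :
  small_rel S (pow P A) A := rel_of (idm (pow P A)).

Definition stable_class (C : category) (S : arrow_class C) : Prop :=
  forall (A B D P : C) (f : hom A D) (g : hom B D) (p : hom P A) (q : hom P B),
    is_pullback f g p q -> in_class S f -> in_class S q.

Definition quotient_class (C : category) (S : arrow_class C) : Prop :=
  forall (X Y A : C) (e : hom X Y) (g : hom Y A),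
    epi e -> in_class S (g \c e) -> in_class S g.

Record small_maps (C : heyting_pretopos) (N : nno C) := SmallMaps {
  small :> arrow_class C;
  small_id : forall A : C, in_class small (idm A);
  small_comp : forall (A B D : C) (f : hom A B) (g : hom B D),
      in_class small f -> in_class small g -> in_class small (g \c f);
  small_stable : stable_class small;
  small_diag : forall A : C, in_class small (diag A);
  small_quotient : quotient_class small;
  small_copair : forall (X Y A : C) (f : hom X A) (g : hom Y A),
      in_class small f -> in_class small g -> in_class small (copair f g);
  small_power : powerclass small;
  small_nat : in_class small (bang N);
  small_universal : exists (E U : C) (univ : hom E U), in_class small univ /\
      forall (A B : C) (f : hom A B), in_class small f ->
        exists (B' : C) (q : hom B' B) (c : hom B' U), epi q /\
          exists h : hom (pb f q) (pb univ c),
            iso h /\ pbr univ c \c h = pbr f q }.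

Lemma equalizer_eq (C : lex) (A B : C) (f g : hom A B) :
  f \c pbl (pair f g) (diag B) = g \c pbl (pair f g) (diag B).
Proof.
have E := pbC (pair f g) (diag B).
have E1 := f_equal (fun h => fst _ _ \c h) E.
have E2 := f_equal (fun h => snd _ _ \c h) E.
move: E1 E2; rewrite /= !compA !fst_pair !snd_pair !comp1m.
by move=> -> ->.
Qed.

Lemma equalizer_mono (C : lex) (A B : C) (f g : hom A B) :
  mono (pbl (pair f g) (diag B)).
Proof.
move=> W h k E; apply: pb_ext; first exact: E.
have E1 := f_equal (fun h => fst _ _ \c h) (pbC (pair f g) (diag B)).
move: E1; rewrite /= !compA !fst_pair !comp1m => <-.
by rewrite -!compA E.
Qed.

Lemma equalizer_factors (C : lex) (A B W : C) (f g : hom A B) (h : hom W A) :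
  f \c h = g \c h -> factors h (pbl (pair f g) (diag B)).
Proof.
move=> E.
have H : pair f g \c h = diag B \c (f \c h).
  by rewrite !pair_comp !comp1m E.
by exists (pb_pair H); rewrite pb_pairl.
Qed.

Lemma cover_epi (C : lex) (A B : C) (e : hom A B) : cover e -> epi e.
Proof.
move=> He Z f g /equalizer_factors [h hE].
have [n [_ mn]] := He _ _ h (@equalizer_mono _ _ _ f g) hE.
by rewrite -(compm1 f) -(compm1 g) -mn !compA equalizer_eq.
Qed.

Section PowerMap.
Variables (C : regular) (S : arrow_class C) (qS : quotient_class S).

Definition rel_imap (I A B : C) (g : hom A B) (R : small_rel S I A) :
  hom (rel_ob R) (prod I B) := prodmap (idm I) g \c rel_map R.

Lemma rel_im_small (I A B : C) (g : hom A B) (R : small_rel S I A) :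
  in_class S (fst I B \c im_mono (rel_imap g R)).
Proof.
apply: (qS (e := im_cover (rel_imap g R))); first by apply: cover_epi; exact: im_coverP.
rewrite -compA im_fact /rel_imap compA fst_prodmap comp1m; exact: rel_small.
Qed.

Definition rel_im (I A B : C) (g : hom A B) (R : small_rel S I A) :
    small_rel S I B :=
  SmallRel (@im_monoP C _ _ (rel_imap g R)) (rel_im_small g R).

Variable P : powerclass S.

(* The functor sends small subobjects to their images along [g]; this is its value
   on the generic one, [mem_rel P A]. *)
Definition pow_map (A B : C) (g : hom A B) : hom (pow P A) (pow P B) :=
  classify P (rel_im g (mem_rel P A)).

Record coalgebra := Coalgebra {
  carrier : C;
  structure : hom carrier (pow P carrier) }.

Definition coalgebra_map (X Y : coalgebra) (f : hom (carrier X) (carrier Y)) :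
    Prop :=
  pow_map f \c structure X = structure Y \c f.

Definition terminal_coalgebra (T : coalgebra) : Prop :=
  forall X : coalgebra,
    exists! f : hom (carrier X) (carrier T), coalgebra_map f.

End PowerMap.

Record slice_ob (C : category) (I : C) := SliceOb { dom : C; arr : hom dom I }.

Record slice_hom (C : category) (I : C) (X Y : slice_ob I) := SliceHom {
  over : hom (dom X) (dom Y);
  overP : arr Y \c over = arr X }.

Lemma over_inj (C : category) (I : C) (X Y : slice_ob I) (f g : slice_hom X Y) :
  over f = over g -> f = g.
Proof.
case: f g => [f Hf] [g Hg] /= E; subst g; congr SliceHom; exact: proof_irrelevance.
Qed.

Section SliceCategory.
Variables (C : category) (I : C).

Definition slice_idm (X : slice_ob I) : slice_hom X X :=
  SliceHom (compm1 (arr X)).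

Lemma slice_compP (X Y Z : slice_ob I) (g : slice_hom Y Z) (f : slice_hom X Y) :
  arr Z \c (over g \c over f) = arr X.
Proof. by rewrite compA !overP. Qed.

Definition slice_comp (X Y Z : slice_ob I) (g : slice_hom Y Z)
  (f : slice_hom X Y) : slice_hom X Z := SliceHom (slice_compP g f).

Definition slice_category : category.
Proof.
refine (@Category (slice_ob I) (@slice_hom C I) slice_idm slice_comp _ _ _).
- move=> X Y f; apply: over_inj; exact: comp1m.
- move=> X Y f; apply: over_inj; exact: compm1.
- move=> X Y Z W h g f; apply: over_inj; exact: compA.
Defined.

End SliceCategory.

Section SliceLex.
Variables (C : lex) (I : C).

Definition slice_one : slice_category I := SliceOb (idm I).

Definition slice_bang (X : slice_category I) : hom X slice_one :=
  @SliceHom _ _ X slice_one (arr X) (comp1m (arr X)).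

Definition slice_pb (X Y Z : slice_category I) (f : hom X Z) (g : hom Y Z) :
    slice_category I :=
  SliceOb (arr X \c pbl (over f) (over g)).

Definition slice_pbl (X Y Z : slice_category I) (f : hom X Z) (g : hom Y Z) :
    hom (slice_pb f g) X :=
  @SliceHom _ _ (slice_pb f g) X (pbl (over f) (over g)) (erefl _).

Lemma slice_pbrP (X Y Z : slice_category I) (f : hom X Z) (g : hom Y Z) :
  arr Y \c pbr (over f) (over g) = arr (slice_pb f g).
Proof. by rewrite /= -(overP f) -(overP g) -!compA pbC. Qed.

Definition slice_pbr (X Y Z : slice_category I) (f : hom X Z) (g : hom Y Z) :
    hom (slice_pb f g) Y :=
  @SliceHom _ _ (slice_pb f g) Y _ (slice_pbrP f g).

Lemma slice_pb_pairC (X Y Z : slice_category I) (f : hom X Z) (g : hom Y Z)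
    (W : slice_category I) (u : hom W X) (v : hom W Y) :
  f \c u = g \c v -> over f \c over u = over g \c over v.
Proof. by move=> /(f_equal (@over _ _ _ _)). Qed.

Lemma slice_pb_pairP (X Y Z : slice_category I) (f : hom X Z) (g : hom Y Z)
    (W : slice_category I) (u : hom W X) (v : hom W Y) (e : f \c u = g \c v) :
  arr (slice_pb f g) \c pb_pair (slice_pb_pairC e) = arr W.
Proof. by rewrite /= -compA pb_pairl overP. Qed.

Definition slice_pb_pair (X Y Z : slice_category I) (f : hom X Z) (g : hom Y Z)
    (W : slice_category I) (u : hom W X) (v : hom W Y) (e : f \c u = g \c v) :
    hom W (slice_pb f g) :=
  @SliceHom _ _ W (slice_pb f g) _ (slice_pb_pairP e).

Definition slice_lex : lex.
Proof.
refine (@Lex (slice_category I) slice_one slice_bang _ slice_pb slice_pbl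
             slice_pbr _ slice_pb_pair _ _ _).
- move=> X f g; apply: over_inj.
  by rewrite -(comp1m (over f)) -(comp1m (over g)) (overP f) (overP g).
- move=> X Y Z f g; apply: over_inj; exact: pbC.
- move=> X Y Z f g W u v e; apply: over_inj; exact: pb_pairl.
- move=> X Y Z f g W u v e; apply: over_inj; exact: pb_pairr.
- move=> X Y Z f g W h k E1 E2; apply: over_inj; apply: pb_ext.
  + exact: (f_equal (@over _ _ _ _) E1).
  + exact: (f_equal (@over _ _ _ _) E2).
Defined.

End SliceLex.

Section SliceFacts.
Variables (C : category) (I : C).

Lemma slice_mono_over (X Y : slice_category I) (m : hom X Y) :
  mono m -> mono (over m).
Proof.
move=> Hm Z f g E.
have E' : arr X \c f = arr X \c g by rewrite -(overP m) -!compA E.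
pose Z' : slice_category I := SliceOb (arr X \c g).
pose f' : hom Z' X := @SliceHom _ _ Z' X f E'.
pose g' : hom Z' X := @SliceHom _ _ Z' X g (erefl _).
have H : m \c f' = m \c g' by apply: over_inj.
exact: (f_equal (@over _ _ _ _) (Hm _ _ _ H)).
Qed.

Lemma over_mono (X Y : slice_category I) (m : hom X Y) :
  mono (over m) -> mono m.
Proof.
move=> Hm Z f g E; apply: over_inj; apply: Hm.
exact: (f_equal (@over _ _ _ _) E).
Qed.

Lemma slice_iso_over (X Y : slice_category I) (f : hom X Y) :
  iso f -> iso (over f).
Proof.
move=> [g [E1 E2]]; exists (over g); split.
- exact: (f_equal (@over _ _ _ _) E1).
- exact: (f_equal (@over _ _ _ _) E2).
Qed.

Lemma over_iso (X Y : slice_category I) (f : hom X Y) :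
  iso (over f) -> iso f.
Proof.
move=> [g [E1 E2]].
have Hg : arr X \c g = arr Y by rewrite -(overP f) -compA E2 compm1.
by exists (@SliceHom _ _ Y X g Hg); split; apply: over_inj.
Qed.

Lemma over_cover (X Y : slice_category I) (e : hom X Y) :
  cover (over e) -> cover e.
Proof.
move=> He M m e' Hm E; apply: over_iso.
apply: (He _ _ (over e')); first exact: slice_mono_over.
exact: (f_equal (@over _ _ _ _) E).
Qed.

Lemma slice_cover_over (X Y : slice_category I) (e : hom X Y) :
  cover e -> cover (over e).
Proof.
move=> He M m e' Hm E.
pose M' : slice_category I := SliceOb (arr Y \c m).
pose m' : hom M' Y := @SliceHom _ _ M' Y m (erefl _).
have He' : arr M' \c e' = arr X by rewrite /= -compA E overP.
pose e'' : hom X M' := @SliceHom _ _ X M' e' He'.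
apply: (@slice_iso_over M' Y m'); apply: (He M' m' e'').
- by apply: over_mono.
- by apply: over_inj.
Qed.

Lemma slice_pullback_over (X Y Z P : slice_category I) (f : hom X Z)
    (g : hom Y Z) (p : hom P X) (q : hom P Y) :
  is_pullback f g p q -> is_pullback (over f) (over g) (over p) (over q).
Proof.
move=> [E H]; split; first exact: (f_equal (@over _ _ _ _) E).
move=> W u v Euv.
pose W' : slice_category I := SliceOb (arr X \c u).
pose u' : hom W' X := @SliceHom _ _ W' X u (erefl _).
have Hv : arr Y \c v = arr W' by rewrite /= -(overP f) -(overP g) -!compA Euv.
pose v' : hom W' Y := @SliceHom _ _ W' Y v Hv.
have Euv' : f \c u' = g \c v' by apply: over_inj.
have [w [[Ew1 Ew2] Hw]] := H _ _ _ Euv'.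
exists (over w); split.
  split; first exact: (f_equal (@over _ _ _ _) Ew1).
  exact: (f_equal (@over _ _ _ _) Ew2).
move=> w' [E1 E2].
have Hw' : arr P \c w' = arr W' by rewrite -(overP p) -compA E1.
have -> : w = @SliceHom _ _ W' P w' Hw' by apply: Hw; split; apply: over_inj.
by [].
Qed.

End SliceFacts.

Section SliceRegular.
Variables (C : regular) (I : C).

Definition slice_im (X Y : slice_lex I) (f : hom X Y) : slice_lex I :=
  SliceOb (arr Y \c im_mono (over f)).

Definition slice_im_mono (X Y : slice_lex I) (f : hom X Y) :
    hom (slice_im f) Y :=
  @SliceHom _ _ (slice_im f) Y (im_mono (over f)) (erefl _).

Lemma slice_im_coverP (X Y : slice_lex I) (f : hom X Y) :
  arr (slice_im f) \c im_cover (over f) = arr X.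
Proof. by rewrite /= -compA im_fact overP. Qed.

Definition slice_im_cover (X Y : slice_lex I) (f : hom X Y) :
    hom X (slice_im f) :=
  @SliceHom _ _ X (slice_im f) _ (slice_im_coverP f).

Definition slice : regular.
Proof.
refine (@Regular (slice_lex I) slice_im slice_im_mono slice_im_cover _ _ _ _).
- move=> X Y f; apply: over_inj; exact: im_fact.
- move=> X Y f; apply: over_mono; exact: im_monoP.
- move=> X Y f; apply: over_cover; exact: im_coverP.
- move=> X Y Z P f g p q H Hf; apply: over_cover.
  apply: (cover_stable (slice_pullback_over H)).
  exact: slice_cover_over.
Defined.

End SliceRegular.

Arguments slice C I : clear implicits.

Definition slice_class (C : regular) (S : arrow_class C) (I : C) :
    arrow_class (slice C I) :=
  fun X Y f => in_class S (over f).

Arguments slice_class {C} S I.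

Lemma slice_quotient (C : regular) (S : arrow_class C) (I : C) :
  quotient_class S -> quotient_class (slice_class S I).
Proof.
move=> HS X Y A e g He; apply: HS => Z f k E.
pose Z' : slice C I := SliceOb (fst I Z).
have Hf : arr Z' \c pair (arr Y) f = arr Y by rewrite fst_pair.
have Hk : arr Z' \c pair (arr Y) k = arr Y by rewrite fst_pair.
have H : (@SliceHom _ _ Y Z' _ Hf : hom Y Z') = @SliceHom _ _ Y Z' _ Hk.
  by apply: He; apply: over_inj; rewrite /= !pair_comp E.
have := f_equal (fun h : slice_hom Y Z' => snd I Z \c over h) H.
by rewrite /= !snd_pair.
Qed.

Section SlicePower.
Variables (C : heyting_pretopos) (S : arrow_class C).
Hypothesis S_stable : stable_class S.
Variable P : powerclass S.

Section PullRel.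
Variables (J Y A : C) (u : hom J Y) (R : small_rel S Y A).

Let r1 := fst Y A \c rel_map R.
Let r2 := snd Y A \c rel_map R.
Let m := pair (pbl u r1) (r2 \c pbr u r1).

Lemma pull_square : is_pullback (prodmap u (idm A)) (rel_map R) m (pbr u r1).
Proof.
split.
  apply: prod_ext; rewrite /m !compA ?fst_prodmap ?snd_prodmap -!compA
    ?fst_pair ?snd_pair ?comp1m; last by rewrite /r2 compA.
  by rewrite pbC /r1 compA.
move=> Z a b E.
have E1 := f_equal (fun h => fst _ _ \c h) E.
have E2 := f_equal (fun h => snd _ _ \c h) E.
move: E1 E2; rewrite /= !compA fst_prodmap snd_prodmap comp1m => E1 E2.
have E1' : u \c (fst J A \c a) = r1 \c b by rewrite compA E1.
exists (pb_pair E1'); split.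
  split; last by rewrite pb_pairr.
  apply: prod_ext; rewrite compA /m ?fst_pair ?snd_pair ?pb_pairl //.
  by rewrite -compA pb_pairr E2.
move=> w [E3 E4]; apply: pb_ext; rewrite ?pb_pairl ?pb_pairr //.
by rewrite -E3 compA /m fst_pair.
Qed.

Lemma pull_mono : mono m.
Proof.
move=> Z f g E; have [H _] := pull_square.
apply: pb_ext.
  by rewrite -(fst_pair (pbl u r1) (r2 \c pbr u r1)) -/m -!compA E.
apply: (@rel_mono _ _ _ _ R).
by rewrite !compA -H -!compA E.
Qed.

Lemma pull_small : in_class S (fst J A \c m).
Proof.
rewrite /m fst_pair.
apply: (S_stable (is_pullback_sym (pb_is_pullback u r1))); exact: rel_small.
Qed.

Definition pull_rel : small_rel S J A := SmallRel pull_mono pull_small.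

End PullRel.

(* The relation classified by [f \c u] is the pullback of that classified by
   [f]. *)
Lemma rel_of_comp (J Y A : C) (f : hom Y (pow P A)) (u : hom J Y) :
  exists k : hom (rel_ob (rel_of (f \c u))) (rel_ob (rel_of f)),
    is_pullback (prodmap u (idm A)) (rel_map (rel_of f))
                (rel_map (rel_of (f \c u))) k.
Proof.
have Hp := pull_square u (rel_of f).
have E : f \c u = classify P (pull_rel u (rel_of f)).
  by rewrite -{1}(rel_ofK f) -(classify_nat P (R' := pull_rel u (rel_of f)) Hp).
have [[h Hh] [h' Hh']] := classifyK P (pull_rel u (rel_of f)).
rewrite -E in h Hh h' Hh'.
have [Hc Hu] := Hp.
exists (pbr u (fst _ _ \c rel_map (rel_of f)) \c h); split.
  by rewrite compA -Hc -compA -Hh.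
move=> Z a b Eab; have [w [[E1 E2] Hw]] := Hu _ _ _ Eab.
exists (h' \c w); split.
  split; first by rewrite compA Hh' -E1.
  rewrite -E2 -compA; congr comp.
  rewrite compA; have -> : h \c h' = idm _; last by rewrite comp1m.
  apply: (@pull_mono _ _ _ u (rel_of f)).
  by rewrite compm1 compA (Hh : rel_map (pull_rel u (rel_of f)) \c h = _) Hh'.
move=> w' [E3 E4].
apply: (@rel_mono _ _ _ _ (rel_of (f \c u))).
rewrite compA Hh' E3; exact: E1.
Qed.

Lemma rel_eq_fst (Y A : C) (R R' : small_rel S Y A) Z (f : hom A Z)
    (g : hom Y Z) : rel_eq R R' ->
  f \c (snd Y A \c rel_map R) = g \c (fst Y A \c rel_map R) ->
  f \c (snd Y A \c rel_map R') = g \c (fst Y A \c rel_map R').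
Proof. by move=> [_ [h <-]] E; rewrite !compA in E *; rewrite E. Qed.

Variable I : C.

(* The powerclass of [X] in the slice over [I] is the subobject of pairs
   (i, a) in I x P_s(dom X) such that [arr X] sends all members of a to i. *)
Section Fibre.
Variable X : slice C I.

Let W := prod I (pow P (dom X)).
Let E := rel_of (snd I (pow P (dom X))).
Let e1 : hom (rel_ob E) W := fst _ _ \c rel_map E.
Let e2 : hom (rel_ob E) (dom X) := snd _ _ \c rel_map E.
Let m := pbl (pair (arr X \c e2) (fst _ _ \c e1)) (diag I).

Definition fibre_sig :
  {N : C & {n : hom N W | mono n /\
     forall (K : C) (k : hom K W), mono k -> factors (pbl e1 k) m <-> factors k n}}.
Proof.
have [N HN] := constructive_indefinite_description _
  (forall_along e1 (@equalizer_mono _ _ _ (arr X \c e2) (fst _ _ \c e1))).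
have [n Hn] := constructive_indefinite_description _ HN.
by exists N, n.
Defined.

Definition fibre : C := projT1 fibre_sig.
Definition fibre_incl : hom fibre W := proj1_sig (projT2 fibre_sig).

Lemma fibre_mono : mono fibre_incl.
Proof. exact: (proj1 (proj2_sig (projT2 fibre_sig))). Qed.

Lemma fibre_factors (J : C) (u : hom J W) :
  factors u fibre_incl <->
  (let R := rel_of (snd _ _ \c u) in
   arr X \c (snd _ _ \c rel_map R) = (fst _ _ \c u) \c (fst _ _ \c rel_map R)).
Proof.
have Hall := proj2 (proj2_sig (projT2 fibre_sig)).
rewrite -/fibre_incl -/fibre in Hall.
have [k [Hk1 Hk2]] := rel_of_comp (snd I (pow P (dom X))) u.
set R := rel_of _ in k Hk1 Hk2 *; rewrite /=.
have K1 : u \c (fst _ _ \c rel_map R) = e1 \c k.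
  by have := f_equal (fun h => fst _ _ \c h) Hk1;
     rewrite /= !compA fst_prodmap.
have K2 : snd _ _ \c rel_map R = e2 \c k.
  by have := f_equal (fun h => snd _ _ \c h) Hk1;
     rewrite /= !compA snd_prodmap comp1m.
split.
  move=> [h Hh].
  have [l Hl] := proj2 (Hall _ _ fibre_mono)
    (ex_intro _ (idm _) (compm1 _)).
  have Q : e1 \c k = fibre_incl \c (h \c (fst _ _ \c rel_map R)).
    by rewrite compA Hh K1.
  have Ek : k = m \c (l \c pb_pair Q) by rewrite compA Hl pb_pairl.
  have Eq : (arr X \c e2) \c m = (fst _ _ \c e1) \c m by exact: equalizer_eq.
  rewrite K2 -compA K1 Ek; move: (l \c _) => x.
  transitivity (arr X \c e2 \c m \c x); first by rewrite -!compA.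
  by rewrite Eq -!compA.
move=> EJ.
suff [h Hh] : factors (im_mono u) fibre_incl.
  by exists (h \c im_cover u); rewrite compA Hh im_fact.
apply: (proj1 (Hall _ _ (@im_monoP _ _ _ u))).
apply: equalizer_factors.
set q := pbl e1 (im_mono u).
have Hc := cover_stable (pb_is_pullback (im_cover u) (pbr e1 (im_mono u)))
                        (@im_coverP _ _ _ u).
set c := pbr (im_cover u) (pbr e1 (im_mono u)) in Hc; set j := pbl (im_cover u) (pbr e1 (im_mono u)).
apply: (cover_epi Hc).
have H1 : e1 \c (q \c c) = u \c j.
  rewrite compA pbC -compA -(pbC (im_cover u)) compA im_fact //.
have H2 : prodmap u (idm _) \c pair j (e2 \c (q \c c))
          = rel_map E \c (q \c c).
  apply: prod_ext.
    by rewrite compA fst_prodmap -compA fst_pair -H1 -compA.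
  by rewrite compA snd_prodmap comp1m snd_pair -compA.
have [w [[W1 W2] _]] := Hk2 _ _ _ H2.
have Hj : j = fst _ _ \c rel_map R \c w by rewrite -compA W1 fst_pair.
have G : arr X \c (e2 \c (q \c c)) = fst _ _ \c (e1 \c (q \c c)).
  rewrite H1 -W2 Hj (compA e2) -K2.
  by rewrite !compA in EJ *; rewrite EJ.
by rewrite !compA in G *.
Qed.

End Fibre.

(* Small relations between [Y] and [X] in the slice are the small relations
   between [dom Y] and [dom X] that lie over [I]. *)
Section Transfer.
Variables Y X : slice C I.

Definition over_rel (R : small_rel S (dom Y) (dom X)) : Prop :=
  arr X \c (snd _ _ \c rel_map R) = arr Y \c (fst _ _ \c rel_map R).

Section Down.
Variable R : small_rel (slice_class S I) Y X.

Let r1 : hom (dom (rel_ob R)) (dom Y) := over (fst Y X \c rel_map R).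
Let r2 : hom (dom (rel_ob R)) (dom X) := over (snd Y X \c rel_map R).

Lemma down_mono : mono (pair r1 r2).
Proof.
move=> Z f g E; apply: (slice_mono_over (@rel_mono _ _ _ _ R)).
have E1 := f_equal (fun h => fst _ _ \c h) E.
have E2 := f_equal (fun h => snd _ _ \c h) E.
move: E1 E2; rewrite /= !compA !fst_pair !snd_pair => E1 E2.
by apply: pb_ext; rewrite !compA; [exact: E1 | exact: E2].
Qed.

Lemma down_small : in_class S (fst _ _ \c pair r1 r2).
Proof. rewrite fst_pair; exact: (@rel_small _ _ _ _ R). Qed.

Definition down_rel : small_rel S (dom Y) (dom X) :=
  SmallRel down_mono down_small.

Lemma down_over : over_rel down_rel.
Proof. by rewrite /over_rel /= fst_pair snd_pair /r1 /r2 !overP. Qed.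

End Down.

Section Up.
Variables (R : small_rel S (dom Y) (dom X)) (HR : over_rel R).

Let R' : slice C I := SliceOb (arr Y \c (fst _ _ \c rel_map R)).
Let r1 : hom R' Y := @SliceHom _ _ R' Y (fst _ _ \c rel_map R) (erefl _).
Let r2 : hom R' X := @SliceHom _ _ R' X (snd _ _ \c rel_map R) HR.

Lemma up_mono : mono (pair r1 r2).
Proof.
apply: over_mono => Z f g E; apply: (@rel_mono _ _ _ _ R).
have E1 := f_equal (fun h => over (fst Y X) \c h) E.
have E2 := f_equal (fun h => over (snd Y X) \c h) E.
have F1 : over (fst Y X) \c over (pair r1 r2) = over r1.
  exact: (f_equal (@over _ _ _ _) (fst_pair r1 r2)).
have F2 : over (snd Y X) \c over (pair r1 r2) = over r2.
  exact: (f_equal (@over _ _ _ _) (snd_pair r1 r2)).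
move: E1 E2; rewrite !compA F1 F2 /= -!compA => E1 E2.
by apply: prod_ext.
Qed.

Lemma up_small : in_class (slice_class S I) (fst Y X \c pair r1 r2).
Proof. rewrite fst_pair; exact: (@rel_small _ _ _ _ R). Qed.

Definition up_rel : small_rel (slice_class S I) Y X :=
  SmallRel up_mono up_small.

End Up.

Lemma down_fst (R : small_rel (slice_class S I) Y X) :
  fst _ _ \c rel_map (down_rel R) = over (fst Y X \c rel_map R).
Proof. exact: fst_pair. Qed.

Lemma down_snd (R : small_rel (slice_class S I) Y X) :
  snd _ _ \c rel_map (down_rel R) = over (snd Y X \c rel_map R).
Proof. exact: snd_pair. Qed.

Lemma down_up (R : small_rel S (dom Y) (dom X)) (HR : over_rel R) :
  rel_eq (down_rel (up_rel HR)) R.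
Proof.
have E : rel_map (down_rel (up_rel HR)) = rel_map R.
  apply: prod_ext.
    transitivity (over (fst Y X \c rel_map (up_rel HR))); first exact: fst_pair.
    by rewrite [rel_map _]/= fst_pair.
    transitivity (over (snd Y X \c rel_map (up_rel HR))); first exact: snd_pair.
    by rewrite [rel_map _]/= snd_pair.
by split; exists (idm _); rewrite compm1.
Qed.

Lemma down_factors (R R' : small_rel (slice_class S I) Y X) :
  factors (rel_map R) (rel_map R') ->
  factors (rel_map (down_rel R)) (rel_map (down_rel R')).
Proof.
move=> [h Hh]; exists (over h); apply: prod_ext; rewrite compA /= ?fst_pair ?snd_pair.
- by rewrite -compA; congr comp; exact: (f_equal (fun k : slice_hom _ _ => over k) Hh).
- by rewrite -compA; congr comp; exact: (f_equal (fun k : slice_hom _ _ => over k) Hh).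
Qed.

Lemma down_eq (R R' : small_rel (slice_class S I) Y X) :
  rel_eq R R' -> rel_eq (down_rel R) (down_rel R').
Proof. by move=> [H1 H2]; split; apply: down_factors. Qed.

Lemma down_inj_factors (R R' : small_rel (slice_class S I) Y X) :
  factors (rel_map (down_rel R)) (rel_map (down_rel R')) ->
  factors (rel_map R) (rel_map R').
Proof.
move=> [h Hh].
have E1 := f_equal (fun h => fst _ _ \c h) Hh.
have E2 := f_equal (fun h => snd _ _ \c h) Hh.
move: E1 E2; rewrite /= !compA !fst_pair !snd_pair => E1 E2.
have HH : arr (rel_ob R') \c h = arr (rel_ob R).
  rewrite -(overP (fst Y X \c rel_map R)) -(overP (fst Y X \c rel_map R')).
  by rewrite -compA; congr comp; exact: E1.
exists (@SliceHom _ _ (rel_ob R) (rel_ob R') h HH).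
apply: (@prod_ext (slice C I)); apply: over_inj; rewrite /= compA.
- exact: E1.
- exact: E2.
Qed.

Lemma down_inj (R R' : small_rel (slice_class S I) Y X) :
  rel_eq (down_rel R) (down_rel R') -> rel_eq R R'.
Proof. by move=> [H1 H2]; split; apply: down_inj_factors. Qed.

End Transfer.

Lemma down_pullback (Y J X : slice C I) (u : hom J Y)
    (R : small_rel (slice_class S I) Y X) (R' : small_rel (slice_class S I) J X)
    (k : hom (rel_ob R') (rel_ob R)) :
  is_pullback (prodmap u (idm X)) (rel_map R) (rel_map R') k ->
  is_pullback (prodmap (over u) (idm (dom X))) (rel_map (down_rel R))
              (rel_map (down_rel R')) (over k).
Proof.
move=> [Ho Hu].
have Ho1 : u \c (fst J X \c rel_map R') = fst Y X \c rel_map R \c k.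
  by rewrite compA -(fst_prodmap u (idm X)) -compA Ho compA.
have Ho2 : snd J X \c rel_map R' = snd Y X \c rel_map R \c k.
  rewrite -(comp1m (snd J X \c rel_map R')) compA.
  by rewrite -(snd_prodmap u (idm X)) -compA Ho compA.
split.
  apply: prod_ext; rewrite !compA ?fst_prodmap ?snd_prodmap ?comp1m -?compA.
    rewrite down_fst compA down_fst.
    exact: (f_equal (fun h : slice_hom _ _ => over h) Ho1).
  rewrite down_snd compA down_snd.
  exact: (f_equal (fun h : slice_hom _ _ => over h) Ho2).
move=> Z a b E.
have E1 : over u \c (fst _ _ \c a) = over (fst Y X \c rel_map R) \c b.
  by rewrite -down_fst -compA -E !compA fst_prodmap.
have E2 : snd _ _ \c a = over (snd Y X \c rel_map R) \c b.
  by rewrite -down_snd -compA -E compA snd_prodmap comp1m.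
pose Z' : slice C I := SliceOb (arr J \c (fst _ _ \c a)).
pose a1 : hom Z' J := @SliceHom _ _ Z' J (fst _ _ \c a) (erefl _).
have Hb : arr (rel_ob R) \c b = arr Z'.
  rewrite -(overP (fst Y X \c rel_map R)) -compA -E1.
  by rewrite compA (overP u).
have Ha2 : arr X \c (snd _ _ \c a) = arr Z'.
  by rewrite E2 compA (overP (snd Y X \c rel_map R)).
pose a2 : hom Z' X := @SliceHom _ _ Z' X (snd _ _ \c a) Ha2.
pose b' : hom Z' (rel_ob R) := @SliceHom _ _ Z' (rel_ob R) b Hb.
have Eab : prodmap u (idm X) \c pair a1 a2 = rel_map R \c b'.
  apply: prod_ext; rewrite compA ?fst_prodmap ?snd_prodmap -compA
    ?fst_pair ?snd_pair ?comp1m compA; apply: over_inj.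
    exact: E1.
  exact: E2.
have [w [[W1 W2] Hw]] := Hu _ _ _ Eab.
exists (over w); split.
  split; last exact: (f_equal (fun h : slice_hom _ _ => over h) W2).
  apply: prod_ext; rewrite compA ?down_fst ?down_snd.
    rewrite -[RHS]/(over a1) -(fst_pair a1 a2) -W1 compA //.
  rewrite -[RHS]/(over a2) -(snd_pair a1 a2) -W1 compA //.
move=> w' [E3 E4].
have F1 : over (fst J X \c rel_map R') \c w' = fst _ _ \c a.
  by rewrite -down_fst -compA E3.
have F2 : over (snd J X \c rel_map R') \c w' = snd _ _ \c a.
  by rewrite -down_snd -compA E3.
have Hw' : arr (rel_ob R') \c w' = arr Z'.
  by rewrite -(overP (fst J X \c rel_map R')) -compA F1.
have -> // : w = @SliceHom _ _ Z' (rel_ob R') w' Hw'.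
apply: Hw; split; last by apply: over_inj.
apply: prod_ext; rewrite ?fst_pair ?snd_pair compA; apply: over_inj.
  exact: F1.
exact: F2.
Qed.

Definition slice_pow (X : slice C I) : slice C I :=
  SliceOb (fst _ _ \c fibre_incl X).

Section SliceClassify.
Variables Y X : slice C I.

Lemma slice_classify_ex (R : small_rel (slice_class S I) Y X) :
  factors (pair (arr Y) (classify P (down_rel R))) (fibre_incl X).
Proof.
apply/fibre_factors; rewrite snd_pair fst_pair /=.
have [H1 H2] := classifyK P (down_rel R).
apply: (rel_eq_fst (R := down_rel R)); first by split.
exact: down_over.
Qed.

Definition slice_classify0 (R : small_rel (slice_class S I) Y X) :=
  proj1_sig (constructive_indefinite_description _ (slice_classify_ex R)).

Lemma slice_classify0E (R : small_rel (slice_class S I) Y X) :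
  fibre_incl X \c slice_classify0 R = pair (arr Y) (classify P (down_rel R)).
Proof.
exact: (proj2_sig (constructive_indefinite_description _ (slice_classify_ex R))).
Qed.

Lemma slice_classifyP (R : small_rel (slice_class S I) Y X) :
  arr (slice_pow X) \c slice_classify0 R = arr Y.
Proof. by rewrite /= -compA slice_classify0E fst_pair. Qed.

Definition slice_classify (R : small_rel (slice_class S I) Y X) :
    hom Y (slice_pow X) := @SliceHom _ _ Y (slice_pow X) _ (slice_classifyP R).

Lemma slice_rel_ofP (f : hom Y (slice_pow X)) :
  over_rel (rel_of (snd _ _ \c (fibre_incl X \c over f))).
Proof.
have := proj1 (fibre_factors (fibre_incl X \c over f))
  (ex_intro _ _ (erefl _)).
rewrite /= /over_rel => ->; congr comp.
by rewrite -(overP f) /= compA.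
Qed.

Definition slice_rel_of (f : hom Y (slice_pow X)) :
    small_rel (slice_class S I) Y X := up_rel (slice_rel_ofP f).

End SliceClassify.

Lemma rel_eq_sym (Y A : C) (R R' : small_rel S Y A) :
  rel_eq R R' -> rel_eq R' R.
Proof. by move=> [H1 H2]. Qed.

Lemma rel_eq_trans (Y A : C) (R R' R'' : small_rel S Y A) :
  rel_eq R R' -> rel_eq R' R'' -> rel_eq R R''.
Proof.
move=> [[a Ha] [b Hb]] [[a' Ha'] [b' Hb']]; split.
- by exists (a' \c a); rewrite compA Ha' Ha.
- by exists (b \c b'); rewrite compA Hb Hb'.
Qed.

Definition slice_power : powerclass (slice_class S I).
Proof.
refine (@Powerclass _ (slice_class S I) slice_pow
          slice_classify slice_rel_of _ _ _ _).
- move=> Y X R R' H; apply: over_inj; apply: (fibre_mono (X := X)).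
  by rewrite !slice_classify0E (classify_eq P (down_eq H)).
- move=> Y X R; apply: down_inj; apply: (rel_eq_trans (down_up _)).
  rewrite /= slice_classify0E snd_pair; exact: classifyK.
- move=> Y X f; apply: over_inj; apply: (fibre_mono (X := X)).
  rewrite slice_classify0E (classify_eq P (down_up _)) rel_ofK.
  apply: prod_ext; rewrite ?fst_pair ?snd_pair //.
  by rewrite compA -(overP f).
- move=> Y J X u R R' k H; apply: over_inj; apply: (fibre_mono (X := X)).
  rewrite /= compA !slice_classify0E pair_comp overP; congr pair.
  exact: (classify_nat P (down_pullback H)).
Defined.

End SlicePower.

Section Reindex.
Variables (C : regular) (I : C).

Definition star (A : C) : slice C I := SliceOb (fst I A).

Lemma star_mapP (A B : C) (f : hom A B) :
  arr (star B) \c prodmap (idm I) f = arr (star A).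
Proof. by rewrite /= fst_prodmap comp1m. Qed.

Definition star_map (A B : C) (f : hom A B) : hom (star A) (star B) :=
  @SliceHom _ _ (star A) (star B) _ (star_mapP f).

Variable S : arrow_class C.
Hypothesis S_stable : stable_class S.

Section StarRel.
Variables (A B : C) (R : small_rel S A B).

Let r1 := fst A B \c rel_map R.
Let r2 := snd A B \c rel_map R.

Lemma star_rel_mono : mono (pair (star_map r1) (star_map r2)).
Proof.
apply: over_mono => Z f g E.
have E1 := f_equal (fun h => over (fst (star A) (star B)) \c h) E.
have E2 := f_equal (fun h => over (snd (star A) (star B)) \c h) E.
have F1 : over (fst (star A) (star B)) \c over (pair (star_map r1) (star_map r2))
    = over (star_map r1).
  exact: (f_equal (fun h : slice_hom _ _ => over h) (fst_pair (C := slice C I) (star_map r1) (star_map r2))).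
have F2 : over (snd (star A) (star B)) \c over (pair (star_map r1) (star_map r2))
    = over (star_map r2).
  exact: (f_equal (fun h : slice_hom _ _ => over h) (snd_pair (C := slice C I) (star_map r1) (star_map r2))).
have G1 : prodmap (idm I) r1 \c f = prodmap (idm I) r1 \c g.
  by move: E1; rewrite !compA F1.
have G2 : prodmap (idm I) r2 \c f = prodmap (idm I) r2 \c g.
  by move: E2; rewrite !compA F2.
apply: prod_ext.
  have := f_equal (fun h => fst _ _ \c h) G1.
  by rewrite /= !compA !fst_prodmap comp1m.
apply: (@rel_mono _ _ _ _ R); apply: prod_ext; rewrite !compA.
  have := f_equal (fun h => snd _ _ \c h) G1.
  by rewrite /= !compA !snd_prodmap.
have := f_equal (fun h => snd _ _ \c h) G2.
by rewrite /= !compA !snd_prodmap.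
Qed.

Lemma star_rel_small :
  in_class (slice_class S I) (fst (star A) (star B) \c pair (star_map r1) (star_map r2)).
Proof.
rewrite fst_pair /slice_class /=.
suff H : is_pullback r1 (snd I A) (snd I (rel_ob R)) (prodmap (idm I) r1).
  apply: (S_stable H); exact: rel_small.
split; first by rewrite snd_prodmap.
move=> Z u v E; exists (pair (fst _ _ \c v) u); split.
  split; first by rewrite snd_pair.
  by apply: prod_ext; rewrite compA ?fst_prodmap ?snd_prodmap -compA
    ?fst_pair ?snd_pair ?comp1m.
move=> w [E1 E2]; apply: prod_ext; rewrite ?fst_pair ?snd_pair //.
by rewrite -E2 compA fst_prodmap comp1m.
Qed.

Definition star_rel : small_rel (slice_class S I) (star A) (star B) :=
  SmallRel star_rel_mono star_rel_small.

End StarRel.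
End Reindex.

Section Indexed.
Variables (C : heyting_pretopos) (N : nno C) (S : small_maps N).

Definition power_coalgebra := coalgebra (small_power S).

Definition power_at (I : C) : powerclass (slice_class S I) :=
  slice_power (@small_stable _ _ S) (small_power S) I.

(* The comparison map I^*(P_s A) -> P_s^I (I^* A) between the values of the
   indexed endofunctor: it classifies the image under I^* of membership on A. *)
Definition star_pow (I A : C) :
    hom (star I (pow (small_power S) A)) (pow (power_at I) (star I A)) :=
  classify (power_at I) (star_rel I (@small_stable _ _ S) (mem_rel _ A)).

Definition star_coalgebra (I : C) (V : power_coalgebra) :
    coalgebra (power_at I) :=
  Coalgebra (star_pow I (carrier V) \c star_map I (structure V)).

Definition indexed_final_coalgebra (V : power_coalgebra) : Prop :=
  forall I : C,
    terminal_coalgebra (slice_quotient (I := I) (@small_quotient _ _ S))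
                       (star_coalgebra I V).

End Indexed.

(* Main.v *)
From Corelib Require Import ssreflect ssrfun.
Require Import Defs.

(** The final coalgebra is built as a quotient of a weakly final one by
    bisimilarity, with generalised elements and Kripke-Joyal semantics as internal
    language: an element of [pow P A] at a stage [Z] is a set [c], membership
    [mem a c] is factorisation through the generic small relation, and existence is
    existence after a cover ([locally]).  For covers to be the right notion,
    the epi in the universal small map axiom has to be a cover; a pretopos is
    balanced, so it is ([epi_cover]).

    Call two elements of coalgebras bisimilar when some small relation that is a
    bisimulation contains both ([bisimilar]).  As the small relations between X and
    Y are the elements of the object P_s(X x Y), bisimilarity is a subobject of
    X x Y ([definable_bisimilar]), and as small relations compose, it is transitive
    across three different coalgebras ([bisimilar_trans]).

    Two facts carry the proof.  First, elements with a common image under coalgebra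
    maps f : X -> V and g : Y -> V are bisimilar ([bisimilar_cospan]).  Since the
    natural numbers are small, every element lies in a small set closed under the
    coalgebra structure ([small_closure]); on two such sets the relation f a = g b
    is small because diagonals are small, and it is a bisimulation.  Second, every
    element of every coalgebra is, after a cover, bisimilar to an element of one
    coalgebra G ([weakly_final]): with E -> U the universal small map, G consists of
    the small graphs on E pointed by a vertex, and a small closed set can be copied
    into E.

    Let q : G -> V be the quotient by bisimilarity; it is a coalgebra map
    ([quotient_coalgebra]).  For a coalgebra X, the relation between x and q g when x
    and g are bisimilar is total by the second fact and single-valued by
    transitivity, so it is the graph of a map f, and f is a coalgebra map.  If f' is
    another one, write f' x = q g after a cover; then x and g are bisimilar by the
    first fact, hence f x = q g ([final_coalgebra]).

    Finality in the slices is a consequence of finality in the base.  A coalgebra X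
    over I is an ordinary coalgebra on its total object in which members stay in
    the fibre, and a map from X to I x V over I is a coalgebra map exactly when its
    component in V is one ([slice_coalgebra_map]). *)

Set Implicit Arguments.
Unset Strict Implicit.
Unset Printing Implicit Defensive.

Local Open Scope cat_scope.

(** * Covers and local existence *)

Section Covers.
Variable C : regular.

Lemma pbr_mono (A B D : C) (m : hom A D) (f : hom B D) :
  mono m -> mono (pbr m f).
Proof.
move=> Hm Z h k E; apply: pb_ext => //; apply: Hm.
by rewrite !compA pbC -!compA E.
Qed.

Lemma factors_comp (A B D Z : C) (m : hom B D) (f : hom A D) (u : hom Z A) :
  factors f m -> factors (f \c u) m.
Proof. by move=> [h <-]; exists (h \c u); rewrite compA. Qed.

Lemma factors_trans (A B B' D : C) (f : hom A D) (m : hom B D) (m' : hom B' D) :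
  factors f m -> factors m m' -> factors f m'.
Proof. by move=> [h <-] [h' <-]; exists (h' \c h); rewrite compA. Qed.

Lemma factors_local (A B D Z : C) (m : hom B D) (f : hom A D) (e : hom Z A) :
  mono m -> cover e -> factors (f \c e) m -> factors f m.
Proof.
move=> Hm He [h Hh].
have [g [_ Hg]] := He _ _ (pb_pair Hh) (pbr_mono Hm) (pb_pairr Hh).
by exists (pbl m f \c g); rewrite compA pbC -compA Hg compm1.
Qed.

Lemma cover_idm (A : C) : cover (idm A).
Proof.
move=> M m h Hm E; exists h; split=> //.
by apply: Hm; rewrite compA E comp1m compm1.
Qed.

Lemma cover_comp (A B D : C) (e : hom B D) (e' : hom A B) :
  cover e -> cover e' -> cover (e \c e').
Proof.
move=> He He' M m h Hm E.
have [k Hk] : factors e m by apply: (factors_local Hm He'); exists h.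
exact: (He _ _ k).
Qed.

Lemma cover_right (A B D : C) (e : hom B D) (f : hom A B) :
  cover (e \c f) -> cover e.
Proof.
move=> H M m h Hm E; apply: (H _ _ (h \c f)) => //.
by rewrite compA E.
Qed.

Lemma cover_mono_iso (A B : C) (m : hom A B) : cover m -> mono m -> iso m.
Proof. by move=> Hc Hm; apply: (Hc _ _ (idm A)) => //; exact: compm1. Qed.

Lemma cover_pbr (A B D : C) (e : hom A D) (f : hom B D) :
  cover e -> cover (pbr e f).
Proof. exact: cover_stable (pb_is_pullback e f). Qed.

(** Kripke-Joyal semantics reads an existential quantifier at stage [Z] as
    existence at some stage covering [Z]. *)
Definition locally (Z : C) (phi : forall Z' : C, hom Z' Z -> Prop) : Prop :=
  exists (Z' : C) (e : hom Z' Z), cover e /\ phi Z' e.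

Lemma locally_now (Z : C) (phi : forall Z' : C, hom Z' Z -> Prop) :
  phi Z (idm Z) -> locally phi.
Proof. by move=> H; exists Z, (idm Z); split=> //; exact: cover_idm. Qed.

Lemma locally_cover (Z Z' : C) (e : hom Z' Z)
    (phi : forall Z' : C, hom Z' Z -> Prop) :
  cover e -> locally (fun Z'' e' => phi Z'' (e \c e')) -> locally phi.
Proof.
move=> He [Z'' [e' [He' H]]]; exists Z'', (e \c e'); split=> //.
exact: cover_comp.
Qed.

Lemma factors_im (A B Z : C) (g : hom A B) (f : hom Z B) :
  factors f (im_mono g) <->
  locally (fun Z' e => exists a : hom Z' A, g \c a = f \c e).
Proof.
split.
  move=> [h Hh]; exists _, (pbr (im_cover g) h); split.
    by apply: cover_pbr; exact: im_coverP.
  exists (pbl (im_cover g) h).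
  by rewrite -Hh -compA -pbC compA im_fact.
move=> [Z' [e [He [a Ha]]]].
apply: (factors_local (@im_monoP _ _ _ _) He); exists (im_cover g \c a).
by rewrite compA im_fact.
Qed.

Lemma pullback_factors (A B D M Z : C) (f : hom A D) (m : hom B D)
    (p : hom M A) (k : hom M B) (z : hom Z A) :
  is_pullback f m p k -> (factors (f \c z) m <-> factors z p).
Proof.
move=> [E H]; split.
  by move=> [h Hh]; have [w [[Hw _] _]] := H _ _ _ (esym Hh); exists w.
by move=> [h <-]; exists (k \c h); rewrite !compA E.
Qed.

Lemma pair_eta (A B Z : C) (t : hom Z (prod A B)) :
  pair (fst A B \c t) (snd A B \c t) = t.
Proof. by apply: prod_ext; rewrite ?fst_pair ?snd_pair. Qed.

Lemma pairP (A B Z : C) (t : hom Z (prod A B)) :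
  exists (a : hom Z A) (b : hom Z B), t = pair a b.
Proof. by exists (fst A B \c t), (snd A B \c t); rewrite pair_eta. Qed.

Lemma pair_inj (A B Z : C) (a a' : hom Z A) (b b' : hom Z B) :
  pair a b = pair a' b' -> a = a' /\ b = b'.
Proof.
move=> E; have E1 := f_equal (fun t => fst _ _ \c t) E.
have E2 := f_equal (fun t => snd _ _ \c t) E.
by move: E1 E2; rewrite /= !fst_pair !snd_pair.
Qed.

Lemma fst_pairA (Z Z' A B : C) (u : hom Z A) (v : hom Z B) (w : hom Z' Z) :
  fst A B \c (pair u v \c w) = u \c w.
Proof. by rewrite compA fst_pair. Qed.

Lemma snd_pairA (Z Z' A B : C) (u : hom Z A) (v : hom Z B) (w : hom Z' Z) :
  snd A B \c (pair u v \c w) = v \c w.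
Proof. by rewrite compA snd_pair. Qed.

Lemma prodmap_pair (Z A A' B B' : C) (f : hom A A') (g : hom B B')
    (u : hom Z A) (v : hom Z B) :
  prodmap f g \c pair u v = pair (f \c u) (g \c v).
Proof. by rewrite /prodmap pair_comp -!compA fst_pair snd_pair. Qed.

Lemma comp_assoc (A B D E : C) (h : hom D E) (g : hom B D) (f : hom A B) :
  (h \c g) \c f = h \c (g \c f).
Proof. by rewrite compA. Qed.

(** Rewriting rules that push composition into pairings and cancel projections. *)
Definition pairE := (comp_assoc, @pair_comp C, @fst_pair C, @snd_pair C,
  fst_pairA, snd_pairA).

End Covers.

(** * Definable predicates and unique choice *)

Section Definable.
Variable C : regular.

(** A predicate on generalised elements of [A] is definable when it is membership
    of a subobject.  Such predicates pass to later stages and are local for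
    covers; the lemmas below are the Kripke-Joyal clauses. *)
Definition definable (A : C) (phi : forall Z : C, hom Z A -> Prop) : Prop :=
  exists (M : C) (m : hom M A),
    mono m /\ forall (Z : C) (f : hom Z A), phi Z f <-> factors f m.

Lemma definable_iff (A : C) (phi psi : forall Z : C, hom Z A -> Prop) :
  (forall Z f, phi Z f <-> psi Z f) -> definable phi -> definable psi.
Proof.
move=> H [M [m [Hm Hf]]]; exists M, m; split=> // Z f.
by rewrite -H.
Qed.

Lemma definable_comp (A : C) (phi : forall Z : C, hom Z A -> Prop) :
  definable phi -> forall (Z Z' : C) (f : hom Z A) (u : hom Z' Z),
  phi Z f -> phi Z' (f \c u).
Proof.
by move=> [M [m [Hm Hf]]] Z Z' f u /Hf H; apply/Hf; apply: factors_comp.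
Qed.

Lemma definable_local (A : C) (phi : forall Z : C, hom Z A -> Prop) :
  definable phi -> forall (Z Z' : C) (f : hom Z A) (e : hom Z' Z),
  cover e -> phi Z' (f \c e) -> phi Z f.
Proof.
move=> [M [m [Hm Hf]]] Z Z' f e He /Hf H; apply/Hf.
exact: factors_local He H.
Qed.

Lemma definable_pre (A B : C) (g : hom B A)
    (phi : forall Z : C, hom Z A -> Prop) :
  definable phi -> definable (fun Z (f : hom Z B) => phi Z (g \c f)).
Proof.
move=> [M [m [Hm Hf]]]; exists _, (pbr m g); split; first exact: pbr_mono.
move=> Z f; rewrite Hf; apply: pullback_factors.
exact: is_pullback_sym (pb_is_pullback m g).
Qed.

Lemma definable_factors (A M : C) (m : hom M A) :
  mono m -> definable (fun Z (f : hom Z A) => factors f m).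
Proof. by move=> Hm; exists M, m. Qed.

Lemma definable_eq (A B : C) (f g : hom A B) :
  definable (fun Z (a : hom Z A) => f \c a = g \c a).
Proof.
exists _, (pbl (pair f g) (diag B)); split; first exact: equalizer_mono.
move=> Z a; split; first exact: equalizer_factors.
by move=> [h <-]; rewrite !compA equalizer_eq.
Qed.

Lemma definable_and (A : C) (phi psi : forall Z : C, hom Z A -> Prop) :
  definable phi -> definable psi ->
  definable (fun Z f => phi Z f /\ psi Z f).
Proof.
move=> [M [m [Hm Hf]]] [M' [m' [Hm' Hf']]].
exists _, (m' \c pbr m m'); split.
  by move=> Z h k; rewrite -!compA => /Hm'; exact: (pbr_mono Hm).
move=> Z f; rewrite Hf Hf'; split.
  move=> [[h Hh] [h' Hh']].
  have E : m \c h = m' \c h' by rewrite Hh.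
  by exists (pb_pair E); rewrite -compA pb_pairr.
move=> [h <-]; split; last by exists (pbr m m' \c h); rewrite compA.
by exists (pbl m m' \c h); rewrite compA pbC.
Qed.

Lemma definable_ex (A B : C) (phi : forall Z : C, hom Z (prod A B) -> Prop) :
  definable phi ->
  definable (fun Z (a : hom Z A) =>
    locally (fun Z' e => exists b : hom Z' B, phi Z' (pair (a \c e) b))).
Proof.
move=> Hd; have [M [m [Hm Hf]]] := Hd.
exists _, (im_mono (fst A B \c m)); split; first exact: im_monoP.
move=> Z a; rewrite factors_im; split.
  move=> [Z' [e [He [b /Hf [h Hh]]]]]; exists Z', e; split=> //.
  by exists h; rewrite -compA Hh fst_pair.
move=> [Z' [e [He [h Hh]]]]; exists Z', e; split=> //.
exists (snd A B \c (m \c h)); rewrite -Hh -compA pair_eta.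
by apply/Hf; exists h.
Qed.

(** A functional relation is the graph of a map: its first projection is a cover
    (totality) and monic (single-valuedness). *)
Lemma unique_choice (A B : C) (phi : forall Z : C, hom Z A -> hom Z B -> Prop) :
  definable (fun Z (t : hom Z (prod A B)) => phi Z (fst A B \c t) (snd A B \c t)) ->
  (forall Z (a : hom Z A),
     locally (fun Z' e => exists b : hom Z' B, phi Z' (a \c e) b)) ->
  (forall Z (a : hom Z A) (b b' : hom Z B), phi Z a b -> phi Z a b' -> b = b') ->
  exists f : hom A B, forall Z (a : hom Z A), phi Z a (f \c a).
Proof.
move=> [M [m [Hm Hf]]] Htot Huniq.
have Hphi Z a b : phi Z a b <-> factors (pair a b) m.
  by rewrite -Hf fst_pair snd_pair.
have Hmono : mono (fst A B \c m).
  move=> Z h k E; apply: Hm; apply: prod_ext; first by rewrite !compA.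
  apply: (Huniq Z (fst A B \c (m \c h))).
    by apply/Hphi; rewrite pair_eta; exists h.
  apply/Hphi; exists k; rewrite compA E -compA.
  by rewrite pair_eta.
have Hcov : cover (fst A B \c m).
  have [Z [e [He [b /Hphi [h Hh]]]]] := Htot _ (idm A).
  apply: (@cover_right _ _ _ _ _ h).
  by rewrite -compA Hh fst_pair comp1m.
have [g [_ Hg]] := cover_mono_iso Hcov Hmono.
exists (snd A B \c (m \c g)) => Z a; apply/Hphi; exists (g \c a).
apply: prod_ext; rewrite ?fst_pair ?snd_pair ?compA //.
by rewrite Hg comp1m.
Qed.

End Definable.

Section HeytingFacts.
Variable C : heyting_pretopos.

Lemma definable_all (A B : C) (phi psi : forall Z : C, hom Z (prod A B) -> Prop) :
  definable phi -> definable psi ->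
  definable (fun Z (a : hom Z A) => forall (Z' : C) (u : hom Z' Z) (b : hom Z' B),
    phi Z' (pair (a \c u) b) -> psi Z' (pair (a \c u) b)).
Proof.
move=> [M [m [Hm Hf]]] Hpsi.
(* The universal quantifier is taken along [M -> A], over the part of [M] on which
   [psi] holds. *)
have [M' [m' [Hm' Hf']]] := definable_pre m Hpsi.
have [N [n [Hn Hall]]] := forall_along (fst A B \c m) Hm'.
exists N, n; split=> // Z a; split.
  move=> H; suff [h Hh] : factors (im_mono a) n.
    by exists (h \c im_cover a); rewrite compA Hh im_fact.
  apply/Hall; first exact: im_monoP.
  set f := fst A B \c m.
  (* The pullback of [f] along the image of [a] is covered by that along [a]. *)
  have Hc := cover_pbr (f := pbr f (im_mono a)) (@im_coverP _ _ _ a).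
  apply: (factors_local Hm' Hc); apply/Hf'.
  set c := pbr (im_cover a) _; set p := pbl f (im_mono a).
  have E : fst A B \c (m \c (p \c c)) = a \c pbl (im_cover a) (pbr f (im_mono a)).
    by rewrite !compA pbC -(compA (im_mono a)) -pbC compA im_fact.
  rewrite -(pair_eta (m \c (p \c c))) E; apply: H; rewrite -E pair_eta.
  by apply/Hf; exists (p \c c).
move=> [h Hh] Z' u b /Hf [k Hk].
have [l Hl] := proj2 (Hall _ _ Hn) (ex_intro _ (idm N) (compm1 n)).
have E : fst A B \c m \c k = n \c (h \c u).
  by rewrite -compA Hk fst_pair compA Hh.
rewrite -Hk; apply/Hf'; exists (l \c pb_pair E).
by rewrite compA Hl pb_pairl.
Qed.

(** * Epimorphisms are covers *)

Lemma zero_initial (Z : C) (z : hom Z (zero C)) : is_initial Z.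
Proof.
apply: (@zero_stable _ _ _ _ z (idm Z) z); split.
  by rewrite compm1 (from_zero_uniq (from_zero _) (idm _)) comp1m.
move=> W u v E; exists u; split.
  by rewrite comp1m E (from_zero_uniq (from_zero _) (idm _)) comp1m.
by move=> w []; rewrite comp1m.
Qed.

Lemma initial_eq (Z A : C) (f g : hom Z A) : is_initial Z -> f = g.
Proof. by move=> H; have [h [_ Hh]] := H A; rewrite -(Hh f I) -(Hh g I). Qed.

Lemma disjoint_initial (A B Z : C) (a : hom Z A) (b : hom Z B) :
  inl A B \c a = inr A B \c b -> is_initial Z.
Proof.
by move=> E; have [w _] := proj2 (sum_disjoint A B) _ _ _ E; apply: zero_initial w.
Qed.

(** Pulling the injections back along [z] splits the stage [Z] into a coproduct, on
    which the factorisation can be defined by cases. *)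
Lemma factors_sum (A B D M Z : C) (z : hom Z (sum A B)) (f : hom Z D)
    (m : hom M D) : mono m ->
  (forall Z' (u : hom Z' Z) (a : hom Z' A), z \c u = inl A B \c a ->
     factors (f \c u) m) ->
  (forall Z' (u : hom Z' Z) (b : hom Z' B), z \c u = inr A B \c b ->
     factors (f \c u) m) ->
  factors f m.
Proof.
move=> Hm Hl Hr.
have [h1 H1] := Hl _ _ _ (pbC z (inl A B)).
have [h2 H2] := Hr _ _ _ (pbC z (inr A B)).
have Hs := sum_stable (pb_is_pullback z (inl A B)) (pb_is_pullback z (inr A B)).
have [h [[E1 E2] _]] := Hs _ h1 h2.
exists h; have [k [_ Hk]] := Hs _ (f \c pbl z (inl A B)) (f \c pbl z (inr A B)).
rewrite -(Hk f) //; apply: esym; apply: Hk.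
by rewrite -!compA E1 E2 H1 H2.
Qed.

(** In a pretopos every mono is the equalizer of its cokernel pair, so a mono that
    is also epic is invertible.  The cokernel pair of [m : M -> B] is the quotient
    of [B + B] that identifies both copies of each element of [M]; with decidable
    summands that equivalence relation can be written without disjunction. *)
Lemma mono_epi_iso (M B : C) (m : hom M B) : mono m -> epi m -> iso m.
Proof.
move=> Hm He.
pose BB := sum B B; pose nabla : hom BB B := copair (idm B) (idm B).
have nl Z (b : hom Z B) : nabla \c (inl B B \c b) = b.
  by rewrite compA copair_inl comp1m.
have nr Z (b : hom Z B) : nabla \c (inr B B \c b) = b.
  by rewrite compA copair_inr comp1m.
pose glue Z (s t : hom Z BB) := nabla \c s = nabla \c t /\
  (forall Z' (u : hom Z' Z) (b : hom Z' B),
     (s \c u = inl B B \c b /\ t \c u = inr B B \c b \/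
      s \c u = inr B B \c b /\ t \c u = inl B B \c b) -> factors b m).
have [R [r [Hr HR]]] : definable (fun Z (w : hom Z (prod BB BB)) =>
    glue Z (fst _ _ \c w) (snd _ _ \c w)).
  have D (i j : hom B BB) : definable (fun Z (w : hom Z (prod BB BB)) =>
      forall Z' (u : hom Z' Z) (b : hom Z' B),
      (fst _ _ \c (fst _ _ \c pair (w \c u) b) = i \c (snd _ _ \c pair (w \c u) b)
       /\ snd _ _ \c (fst _ _ \c pair (w \c u) b) = j \c (snd _ _ \c pair (w \c u) b))
      -> factors (snd _ _ \c pair (w \c u) b) m).
    apply: (definable_all (phi := fun Z t => fst _ _ \c (fst _ _ \c t) =
      i \c (snd _ _ \c t) /\ snd _ _ \c (fst _ _ \c t) = j \c (snd _ _ \c t))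
      (psi := fun Z t => factors (snd _ _ \c t) m)).
      apply: definable_and.
        apply: definable_iff (definable_eq (fst _ _ \c fst (prod BB BB) B)
                                           (i \c snd (prod BB BB) B)).
        by move=> Z f; rewrite !compA.
      apply: definable_iff (definable_eq (snd _ _ \c fst (prod BB BB) B)
                                         (j \c snd (prod BB BB) B)).
      by move=> Z f; rewrite !compA.
    exact: definable_pre (definable_factors Hm).
  have D0 := definable_eq (nabla \c fst BB BB) (nabla \c snd BB BB).
  apply: definable_iff (definable_and D0 (definable_and
    (D (inl B B) (inr B B)) (D (inr B B) (inl B B)))).
  move=> Z w; rewrite /glue -!compA; split.
    move=> [E [H1 H2]]; split=> // Z' u b [] H.
      by have := H1 Z' u b; rewrite fst_pair snd_pair !compA; apply; rewrite -!compA in H *.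
    by have := H2 Z' u b; rewrite fst_pair snd_pair !compA; apply; rewrite -!compA in H *.
  move=> [E H]; split=> //; split=> Z' u b; rewrite fst_pair snd_pair => H';
    apply: (H Z' u b); rewrite -!compA; by [left | right].
have Hglue Z (s t : hom Z BB) : glue Z s t <-> factors (pair s t) r.
  by rewrite -HR fst_pair snd_pair.
have no Z' (b b' : hom Z' B) : inl B B \c b = inr B B \c b' -> factors b m.
  move=> /disjoint_initial HZ; have [h _] := HZ M.
  by exists h; apply: initial_eq.
have Hequiv : equivalence_relation (fst BB BB \c r) (snd BB BB \c r).
  split; first by rewrite pair_eta.
  split.
    have [d Hd] : factors (pair (idm BB) (idm BB)) r.
      apply/Hglue; split=> // Z' u b; rewrite comp1m.
      case=> [[-> E]|[E' E]]; first exact: no E.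
      by apply: (no _ _ b); rewrite -E.
    by exists d; rewrite -!compA Hd fst_pair snd_pair.
  split.
    have [d Hd] : factors (pair (snd BB BB \c r) (fst BB BB \c r)) r.
      have [E H] : glue _ (fst BB BB \c r) (snd BB BB \c r).
        by apply/Hglue; rewrite pair_eta; exists (idm R); rewrite compm1.
      apply/Hglue; split=> // Z' u b Hb; apply: (H Z' u b).
      by case: Hb => -[H1 H2]; [right | left].
    by exists d; rewrite -!compA Hd fst_pair snd_pair.
  set r1 := fst BB BB \c r; set r2 := snd BB BB \c r.
  have Hg Z (k : hom Z R) : glue _ (r1 \c k) (r2 \c k).
    by apply/Hglue; rewrite -!compA pair_eta; exists k.
  have [d Hd] : factors (pair (r1 \c pbl r2 r1) (r2 \c pbr r2 r1)) r.
    have [E1 H1] := Hg _ (pbl r2 r1); have [E2 H2] := Hg _ (pbr r2 r1).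
    apply/Hglue; split; first by rewrite E1 pbC E2.
    move=> Z u b Hb.
    (* Decide in which summand the middle element lies. *)
    have Eb : nabla \c (r2 \c pbl r2 r1 \c u) = b.
      by rewrite compA -E1 -compA; case: Hb => -[-> _].
    have Eb' Z' (v : hom Z' Z) (i : hom B BB) b' : nabla \c (i \c b') = b' ->
        r2 \c pbl r2 r1 \c u \c v = i \c b' -> b' = b \c v.
      by move=> Hi Hv; rewrite -Eb -(compA nabla) Hv Hi.
    apply: (factors_sum (z := r2 \c pbl r2 r1 \c u) Hm) => Z' v b' Ev.
      have Ebv := Eb' _ _ _ _ (nl _ b') Ev; rewrite -Ebv.
      case: Hb => -[F1 F2].
        apply: (H2 _ (u \c v)); left; rewrite -pbC compA Ev; split=> //.
        by rewrite compA F2 -compA Ebv.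
      apply: (H1 _ (u \c v)); right; rewrite !compA Ev; split=> //.
      by rewrite F1 -compA Ebv.
    have Ebv := Eb' _ _ _ _ (nr _ b') Ev; rewrite -Ebv.
    case: Hb => -[F1 F2].
      apply: (H1 _ (u \c v)); left; rewrite !compA Ev; split=> //.
      by rewrite F1 -compA Ebv.
    apply: (H2 _ (u \c v)); right; rewrite -pbC compA Ev; split=> //.
    by rewrite compA F2 -compA Ebv.
  by exists d; split; rewrite -(compA _ r) Hd ?fst_pair ?snd_pair.
have [Q [q [Eq Hq]]] := effective Hequiv.
have Em : q \c inl B B = q \c inr B B.
  apply: He; rewrite -!compA.
  have [k Hk] : factors (pair (inl B B \c m) (inr B B \c m)) r.
    apply/Hglue; split; first by rewrite nl nr.
    move=> Z u b; rewrite -!compA => -[[/inl_mono <- _]|[E _]]; first by exists u.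
    by apply: (no _ _ b); rewrite -E; congr comp; rewrite -(nl _ (m \c u)) E nr.
  have E1 := f_equal (fun w => q \c (fst BB BB \c w)) Hk.
  have E2 := f_equal (fun w => q \c (snd BB BB \c w)) Hk.
  move: E1 E2; rewrite /= fst_pair snd_pair => <- <-.
  by rewrite !compA in Eq *; rewrite Eq.
have [k [[K1 K2] _]] := Hq _ _ _ Em.
have [_ HG] : glue _ (inl B B) (inr B B).
  by apply/Hglue; exists k; rewrite -K1 -K2 -!compA pair_eta.
have [h Hh] : factors (idm B) m.
  by apply: (HG _ (idm B)); left; rewrite !compm1.
exists h; split=> //; apply: Hm; by rewrite compA Hh comp1m compm1.
Qed.

Lemma epi_cover (A B : C) (e : hom A B) : epi e -> cover e.
Proof.
move=> He M m h Hm E; apply: mono_epi_iso => // Z f g H; apply: He.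
by rewrite -E !compA H.
Qed.

End HeytingFacts.

(** * Small sets *)

Section Small.
Variables (C : heyting_pretopos) (N : nno C) (S : small_maps N).

Local Notation P := (small_power S).
Local Notation pw A := (pow P A).

Lemma small_pullback (A B D : C) (g : hom A D) (f : hom B D) :
  in_class S g -> in_class S (pbr g f).
Proof. exact: small_stable (pb_is_pullback g f). Qed.

(** [f] is the composite of its graph in the fibre product with a pullback of
    [g \c f], and the graph is a pullback of a diagonal. *)
Lemma small_cancel (A B D : C) (f : hom A B) (g : hom B D) :
  in_class S (g \c f) -> in_class S f.
Proof.
move=> H.
have E0 : g \c f \c idm A = g \c f by rewrite compm1.
rewrite -(pb_pairr E0); apply: small_comp; last exact: small_pullback.
apply: (@small_stable _ _ S _ _ _ _ (diag B)
  (pair (f \c pbl (g \c f) g) (pbr (g \c f) g)) f); last exact: small_diag.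
split; first by rewrite !pair_comp !comp1m -compA pb_pairl pb_pairr compm1.
move=> Z u v E.
have E1 := f_equal (fun t => fst _ _ \c t) E.
have E2 := f_equal (fun t => snd _ _ \c t) E.
move: E1 E2; rewrite /= !compA !fst_pair !snd_pair !comp1m => E1 E2.
exists (pbl (g \c f) g \c v); split.
  split; first by rewrite compA -E1.
  apply: pb_ext; rewrite compA ?pb_pairl ?pb_pairr ?comp1m //.
  by rewrite compA -E2 -E1.
by move=> w [_ <-]; rewrite compA pb_pairl comp1m.
Qed.

(** Generalised elements of [pow P A] are sets; [mem a c] is Kripke-Joyal
    membership at the common stage of [a] and [c]. *)
Definition mem (A Z : C) (a : hom Z A) (c : hom Z (pw A)) : Prop :=
  factors (pair c a) (rel_map (mem_rel P A)).

Lemma mem_comp (A Z Z' : C) (a : hom Z A) (c : hom Z (pw A)) (u : hom Z' Z) :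
  mem a c -> mem (a \c u) (c \c u).
Proof. by rewrite /mem -pair_comp; exact: factors_comp. Qed.

Lemma mem_local (A Z Z' : C) (a : hom Z A) (c : hom Z (pw A)) (e : hom Z' Z) :
  cover e -> mem (a \c e) (c \c e) -> mem a c.
Proof.
move=> He; rewrite /mem -pair_comp; apply: factors_local He.
exact: rel_mono.
Qed.

Lemma definable_mem (A B : C) (a : hom B A) (c : hom B (pw A)) :
  definable (fun Z (b : hom Z B) => mem (a \c b) (c \c b)).
Proof.
apply: definable_iff
  (definable_pre (pair c a) (definable_factors (@rel_mono _ _ _ _ (mem_rel P A)))).
by move=> Z b; rewrite pair_comp.
Qed.

Lemma mem_classify (I A Z : C) (R : small_rel S I A) (u : hom Z I) (a : hom Z A) :
  mem a (classify P R \c u) <-> factors (pair u a) (rel_map R).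
Proof.
have := rel_of_comp (@small_stable _ _ S) (idm (pw A)) (classify P R).
rewrite comp1m => -[k Hk].
rewrite /mem -[X in pair _ X]comp1m -prodmap_pair.
have [F F'] := classifyK P R.
split=> [/(proj1 (pullback_factors _ Hk)) H|H]; first exact: factors_trans H F.
by apply/(pullback_factors _ Hk); exact: factors_trans H F'.
Qed.

Lemma mem_rel_of (A B Z : C) (c : hom B (pw A)) (b : hom Z B) (a : hom Z A) :
  mem a (c \c b) <-> factors (pair b a) (rel_map (rel_of c)).
Proof. by have := mem_classify (rel_of c) b a; rewrite rel_ofK. Qed.

(** Extensionality: a map into [pow P A] is determined by the small relation that
    it classifies. *)
Lemma mem_ext (A B : C) (c d : hom B (pw A)) :
  (forall Z (u : hom Z B) (a : hom Z A), mem a (c \c u) <-> mem a (d \c u)) ->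
  c = d.
Proof.
move=> H; rewrite -(rel_ofK c) -(rel_ofK d); apply: classify_eq.
have K (c' : hom B (pw A)) : forall Z (w : hom Z (prod B A)),
    factors w (rel_map (rel_of c')) <->
    mem (snd _ _ \c w) (c' \c (fst _ _ \c w)).
  by move=> Z w; rewrite mem_rel_of pair_eta.
by split; apply/K/H/K; exists (idm _); rewrite compm1.
Qed.

Lemma mem_family (A B : C) (c : hom B (pw A)) :
  exists (M : C) (g : hom M B) (h : hom M A), in_class S g /\
    forall Z (b : hom Z B) (a : hom Z A),
      mem a (c \c b) <-> exists m : hom Z M, g \c m = b /\ h \c m = a.
Proof.
pose R := rel_of c.
exists (rel_ob R), (fst _ _ \c rel_map R), (snd _ _ \c rel_map R).
split; first exact: rel_small.
move=> Z b a; rewrite mem_rel_of; split.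
  by move=> [h Hh]; exists h; rewrite -!compA Hh fst_pair snd_pair.
by move=> [m [<- <-]]; exists m; rewrite -!compA pair_eta.
Qed.

(** A small family of elements has an image set, because small maps may be
    quotiented on the left. *)
Lemma small_image (M B Y : C) (g : hom M B) (h : hom M Y) : in_class S g ->
  exists s : hom B (pw Y), forall Z (b : hom Z B) (y : hom Z Y),
    mem y (s \c b) <->
    locally (fun Z' e => exists m : hom Z' M, g \c m = b \c e /\ h \c m = y \c e).
Proof.
move=> Hg.
have HR : in_class S (fst B Y \c im_mono (pair g h)).
  apply: (@small_quotient _ _ S _ _ _ (im_cover (pair g h))).
    by apply: cover_epi; exact: im_coverP.
  by rewrite -compA im_fact fst_pair.
exists (classify P (SmallRel (@im_monoP _ _ _ (pair g h)) HR)) => Z b y.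
rewrite mem_classify /= factors_im; split=> -[Z' [e [He [m Hm]]]];
  exists Z', e; split=> //; exists m.
  by move: Hm; rewrite !pair_comp => /pair_inj.
by case: Hm; rewrite !pair_comp => -> ->.
Qed.

Lemma singleton (B Y : C) (h : hom B Y) :
  exists s : hom B (pw Y), forall Z (b : hom Z B) (y : hom Z Y),
    mem y (s \c b) <-> h \c b = y.
Proof.
have [s Hs] := small_image h (@small_id _ _ S B).
exists s => Z b y; rewrite Hs; split.
  move=> [Z' [e [He [m []]]]]; rewrite comp1m => -> E.
  by apply: (cover_epi He); rewrite -compA.
by move=> E; apply: locally_now; exists b; rewrite comp1m !compm1.
Qed.

(** A dependent sum of small families is small because small maps compose. *)
Lemma set_comprehension (A B W Y : C) (c : hom B (pw A))
    (d : hom (prod B A) (pw Y)) (h : hom (prod (prod B A) Y) W) :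
  exists s : hom B (pw W), forall Z (b : hom Z B) (w : hom Z W),
    mem w (s \c b) <->
    locally (fun Z' e => exists (a : hom Z' A) (y : hom Z' Y),
      mem a (c \c (b \c e)) /\ mem y (d \c pair (b \c e) a) /\
      h \c pair (pair (b \c e) a) y = w \c e).
Proof.
have [M [g [k [Hg HM]]]] := mem_family c.
have [M' [g' [k' [Hg' HM']]]] := mem_family (d \c pair g k).
have [s Hs] := small_image (h \c pair (pair g k \c g') k') (small_comp Hg' Hg).
exists s => Z b w; rewrite Hs; split=> -[Z' [e [He]]].
  move=> [m [E1 E2]]; exists Z', e; split=> //.
  exists (k \c (g' \c m)), (k' \c m); split.
    by apply/HM; exists (g' \c m); rewrite compA.
  rewrite -E1 -!compA -pair_comp; split; first by rewrite compA; apply/HM'; exists m.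
  by rewrite -E2 -!compA; congr comp; rewrite [RHS]pair_comp -compA.
move=> [a [y [/HM [m [Em1 Em2]] [Hy E]]]]; exists Z', e; split=> //.
have [m' [Em'1 Em'2]] : exists m', g' \c m' = m /\ k' \c m' = y.
  by apply/HM'; rewrite -compA pair_comp Em1 Em2.
exists m'; split; first by rewrite -compA Em'1.
by rewrite -E -compA pair_comp -compA Em'1 Em'2 pair_comp Em1 Em2.
Qed.

Lemma replacement (A B W : C) (c : hom B (pw A)) (h : hom (prod B A) W) :
  exists s : hom B (pw W), forall Z (b : hom Z B) (w : hom Z W),
    mem w (s \c b) <->
    locally (fun Z' e => exists a : hom Z' A,
      mem a (c \c (b \c e)) /\ h \c pair (b \c e) a = w \c e).
Proof.
have [d Hd] := singleton (bang (prod B A)).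
have [s Hs] := set_comprehension c d (h \c fst _ _).
exists s => Z b w; rewrite Hs; split=> -[Z' [e [He]]].
  move=> [a [y [Ha [_ E]]]]; exists Z', e; split=> //; exists a; split=> //.
  by rewrite -E -compA fst_pair.
move=> [a [Ha E]]; exists Z', e; split=> //; exists a, (bang Z'); split=> //.
by split; [apply/Hd; exact: bang_uniq | rewrite -compA fst_pair].
Qed.

Lemma union_of (A B Y : C) (c : hom B (pw A)) (d : hom (prod B A) (pw Y)) :
  exists s : hom B (pw Y), forall Z (b : hom Z B) (y : hom Z Y),
    mem y (s \c b) <->
    locally (fun Z' e => exists a : hom Z' A,
      mem a (c \c (b \c e)) /\ mem (y \c e) (d \c pair (b \c e) a)).
Proof.
have [s Hs] := set_comprehension c d (snd _ _).
exists s => Z b y; rewrite Hs; split=> -[Z' [e [He]]].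
  move=> [a [y' [Ha [Hy' E]]]]; exists Z', e; split=> //; exists a; split=> //.
  by rewrite -E snd_pair.
move=> [a [Ha Hy]]; exists Z', e; split=> //; exists a, (y \c e); split=> //.
by split=> //; rewrite snd_pair.
Qed.

(** The sections of a set of pairs are sets because equality is small. *)
Lemma section_set (Y W : C) :
  exists s : hom (prod (pw (prod Y W)) Y) (pw W),
    forall Z (H : hom Z (pw (prod Y W))) (y : hom Z Y) (w : hom Z W),
      mem w (s \c pair H y) <-> mem (pair y w) H.
Proof.
have [M [g [h [Hg HM]]]] := mem_family (idm (pw (prod Y W))).
have Hk : in_class S (pair g (fst _ _ \c h)).
  by apply: (@small_cancel _ _ _ _ (fst _ _)); rewrite fst_pair.
have [s Hs] := small_image (snd _ _ \c h) Hk.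
exists s => Z H y w; rewrite Hs; split.
  move=> [Z' [e [He [m []]]]]; rewrite !pair_comp => /pair_inj [E1 E2] E3.
  apply: (mem_local He); rewrite -(comp1m (H \c e)); apply/HM.
  by exists m; rewrite E1 pair_comp -E2 -E3 -!compA pair_eta.
move=> Hyw; apply: locally_now.
have /HM [m [<- E]] : mem (pair y w) (idm _ \c H) by rewrite comp1m.
exists m; rewrite !compm1 pair_comp -!compA E fst_pair snd_pair.
by [].
Qed.

Lemma mem_pow_map (A B Z : C) (g : hom A B) (c : hom Z (pw A)) (b : hom Z B) :
  mem b (pow_map (@small_quotient _ _ S) P g \c c) <->
  locally (fun Z' e => exists a : hom Z' A, mem a (c \c e) /\ g \c a = b \c e).
Proof.
rewrite mem_classify /= factors_im; split=> -[Z' [e [He]]].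
  move=> [m]; rewrite /rel_imap -compA -(pair_eta (rel_map _ \c m)).
  rewrite prodmap_pair comp1m pair_comp => /pair_inj [E1 E2].
  exists Z', e; split=> //; exists (snd _ _ \c (rel_map (mem_rel P A) \c m)).
  by split=> //; rewrite -E1 /mem pair_eta; exists m.
move=> [a [[m Hm] E]]; exists Z', e; split=> //; exists m.
by rewrite /rel_imap -compA Hm prodmap_pair comp1m pair_comp E.
Qed.

End Small.

(** * Small relations and small closed sets *)

Section Relations.
Variables (C : heyting_pretopos) (N : nno C) (S : small_maps N).

Local Notation P := (small_power S).
Local Notation pw A := (pow P A).

Definition image (A B : C) (g : hom A B) : hom (pw A) (pw B) :=
  pow_map (@small_quotient _ _ S) P g.

Definition converse (X Y : C) : hom (pw (prod X Y)) (pw (prod Y X)) :=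
  image (pair (snd X Y) (fst X Y)).

Lemma mem_converse (X Y Z : C) (F : hom Z (pw (prod X Y))) (x : hom Z X)
    (y : hom Z Y) :
  mem (pair y x) (converse X Y \c F) <-> mem (pair x y) F.
Proof.
rewrite mem_pow_map; split.
  move=> [Z' [e [He [t [Ht]]]]]; rewrite !pair_comp => /pair_inj [E1 E2].
  apply: (mem_local He).
  by rewrite pair_comp -E1 -E2 pair_eta.
move=> H; apply: locally_now; exists (pair x y); rewrite !compm1; split=> //.
by rewrite pair_comp fst_pair snd_pair.
Qed.

Lemma converseK (X Y Z : C) (F : hom Z (pw (prod X Y))) :
  converse Y X \c (converse X Y \c F) = F.
Proof.
by apply: mem_ext => Z' u t; rewrite -(pair_eta t) -!compA !mem_converse.
Qed.

Lemma mem_graph (A V Z : C) (f : hom A V) (c : hom Z (pw A)) (a : hom Z A)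
    (v : hom Z V) :
  mem (pair a v) (image (pair (idm A) f) \c c) <-> mem a c /\ f \c a = v.
Proof.
rewrite mem_pow_map; split.
  move=> [Z' [e [He [t [Ht]]]]].
  rewrite !pair_comp comp1m => /pair_inj [E1 E2]; split.
    by apply: (mem_local He); rewrite -E1.
  by apply: (cover_epi He); rewrite -E2 E1 compA.
move=> [H E]; apply: locally_now; exists a; rewrite !compm1; split=> //.
by rewrite pair_comp comp1m E.
Qed.

Lemma relation_bind (A X Y B : C) (F : hom B (pw (prod A X)))
    (d : hom (prod B X) (pw Y)) :
  exists s : hom B (pw (prod A Y)),
    forall Z (b : hom Z B) (a : hom Z A) (y : hom Z Y),
    mem (pair a y) (s \c b) <->
    locally (fun Z' e => exists x : hom Z' X,
      mem (pair (a \c e) x) (F \c (b \c e)) /\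
      mem (y \c e) (d \c pair (b \c e) x)).
Proof.
have [s Hs] := set_comprehension F
  (d \c pair (fst B (prod A X)) (snd A X \c snd B (prod A X)))
  (pair (fst A X \c (snd B (prod A X) \c fst _ Y)) (snd _ Y)).
exists s => Z b a y; rewrite Hs; split=> -[Z' [e [He]]].
  move=> [t [y' [Ht [Hy]]]]; rewrite !pair_comp -!compA fst_pair !snd_pair.
  move=> /pair_inj [E1 E2]; exists Z', e; split=> //; exists (snd _ _ \c t).
  rewrite -E1 pair_eta; split=> //.
  by move: Hy; rewrite E2 -compA pair_comp fst_pair -compA snd_pair.
move=> [x [H1 H2]]; exists Z', e; split=> //; exists (pair (a \c e) x), (y \c e).
split=> //; split; first by rewrite -compA pair_comp fst_pair -compA !snd_pair.
by rewrite !pair_comp -!compA fst_pair !snd_pair fst_pair.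
Qed.

Lemma relation_comp (A X Y B : C) (F : hom B (pw (prod A X)))
    (H : hom B (pw (prod X Y))) :
  exists s : hom B (pw (prod A Y)),
    forall Z (b : hom Z B) (a : hom Z A) (y : hom Z Y),
    mem (pair a y) (s \c b) <->
    locally (fun Z' e => exists x : hom Z' X,
      mem (pair (a \c e) x) (F \c (b \c e)) /\
      mem (pair x (y \c e)) (H \c (b \c e))).
Proof.
have [sec Hsec] := section_set S X Y.
have [s Hs] := relation_bind F (sec \c prodmap H (idm X)).
exists s => Z b a y; rewrite Hs; split=> -[Z' [e [He [x [H1 H2]]]]];
  exists Z', e; split=> //; exists x; split=> //;
  by move: H2; rewrite -compA prodmap_pair comp1m Hsec.
Qed.

(** Iterating [xi] along the natural numbers and taking the union, which is small
    because the natural numbers are, puts every element into a small set closed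
    under [xi]. *)
Lemma small_closure (X : C) (xi : hom X (pw X)) :
  exists cl : hom X (pw X),
    (forall Z (x : hom Z X), mem x (cl \c x)) /\
    (forall Z (x y z : hom Z X),
       mem y (cl \c x) -> mem z (xi \c y) -> mem z (cl \c x)).
Proof.
have [sg Hsg] := singleton S (idm X).
have [un Hun] := union_of (idm (pw X)) (xi \c snd (pw X) X).
have [it [[it0 itS] _]] := nat_rec N sg (un \c snd X (pw X)).
have HN : in_class S (fst X N).
  apply: (small_stable (s := S)
    (is_pullback_sym (pb_is_pullback (bang X) (bang N)))).
  exact: small_nat.
have [nats Hnats] := small_image (snd X N) HN.
have [cl Hcl] := union_of nats it.
have memit Z (x y : hom Z X) (n : hom Z N) :
    mem y (it \c pair x n) -> mem y (cl \c x).
  move=> H; apply/Hcl; apply: locally_now; exists n; rewrite !compm1; split=> //.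
  apply/Hnats; apply: locally_now; exists (pair x n).
  by rewrite fst_pair snd_pair !compm1.
exists cl; split=> Z x.
  apply: (memit _ _ _ (nat_zero N \c bang Z)).
  have -> : pair x (nat_zero N \c bang Z) = pair (idm X) (nat_zero N \c bang X) \c x.
    rewrite pair_comp comp1m -compA; congr pair; congr comp; exact: bang_uniq.
  by rewrite compA it0; apply/Hsg; rewrite comp1m.
move=> y z /Hcl [Z' [e [He [n [_ Hy]]]]] Hz; apply: (mem_local He).
rewrite -compA; apply: (memit _ _ _ (nat_succ N \c n)).
have -> : pair (x \c e) (nat_succ N \c n) = prodmap (idm X) (nat_succ N) \c pair (x \c e) n.
  by rewrite prodmap_pair comp1m.
rewrite compA itS -!compA pair_comp snd_pair; apply/Hun; apply: locally_now.
exists (y \c e); rewrite !compm1 comp1m; split=> //.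
by rewrite -compA snd_pair compA; exact: mem_comp.
Qed.

End Relations.

(** * Small bisimulations *)

Section Bisimulation.
Variables (C : heyting_pretopos) (N : nno C) (S : small_maps N).

Local Notation P := (small_power S).
Local Notation pw A := (pow P A).

Lemma coalgebra_map_mem (X Y : C) (xi : hom X (pw X)) (eta : hom Y (pw Y))
    (f : hom X Y) :
  image S f \c xi = eta \c f <->
  (forall Z (x x' : hom Z X), mem x' (xi \c x) -> mem (f \c x') (eta \c (f \c x)))
  /\
  (forall Z (x : hom Z X) (y : hom Z Y), mem y (eta \c (f \c x)) ->
     locally (fun Z' e =>
       exists x' : hom Z' X, mem x' (xi \c (x \c e)) /\ f \c x' = y \c e)).
Proof.
split.
  move=> E; split=> Z x x'.
    move=> H; rewrite (compA eta) -E -compA mem_pow_map.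
    by apply: locally_now; exists x'; rewrite !compm1.
  rewrite (compA eta) -E -compA mem_pow_map => -[Z' [e [He [a [Ha Hf]]]]].
  by exists Z', e; split=> //; exists a; rewrite compA.
move=> [H1 H2]; apply: mem_ext => Z x y; rewrite -!compA mem_pow_map; split.
  move=> [Z' [e [He [x' [Hx' E]]]]]; apply: (mem_local He); rewrite -E -!compA.
  by apply: H1; rewrite compA.
move=> /H2 [Z' [e [He [x' [Hx' E]]]]]; exists Z', e; split=> //; exists x'.
by rewrite -compA.
Qed.

Definition simulation (X Y : C) (xi : hom X (pw X)) (eta : hom Y (pw Y)) (Z : C)
    (F : hom Z (pw (prod X Y))) : Prop :=
  forall Z' (u : hom Z' Z) (x : hom Z' X) (y : hom Z' Y) (x' : hom Z' X),
    mem (pair x y) (F \c u) -> mem x' (xi \c x) ->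
    locally (fun Z'' e => exists y' : hom Z'' Y,
      mem y' (eta \c (y \c e)) /\ mem (pair (x' \c e) y') (F \c (u \c e))).

Definition bisimulation (X Y : C) (xi : hom X (pw X)) (eta : hom Y (pw Y)) (Z : C)
    (F : hom Z (pw (prod X Y))) : Prop :=
  simulation xi eta F /\ simulation eta xi (converse S X Y \c F).

(** Bisimulations are required to be small so that the existential quantifier
    ranges over an object of [C]; this makes bisimilarity definable. *)
Definition bisimilar (X Y : C) (xi : hom X (pw X)) (eta : hom Y (pw Y)) (Z : C)
    (x : hom Z X) (y : hom Z Y) : Prop :=
  locally (fun Z' e => exists F : hom Z' (pw (prod X Y)),
    bisimulation xi eta F /\ mem (pair (x \c e) (y \c e)) F).

Lemma definable_simulation (X Y : C) (xi : hom X (pw X)) (eta : hom Y (pw Y)) :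
  definable (fun Z (F : hom Z (pw (prod X Y))) => simulation xi eta F).
Proof.
(* A point of [T] is a triple ((x, y), x') to which the defining clause applies. *)
pose T := prod (prod X Y) X.
pose K := prod (pw (prod X Y)) T.
pose t : hom K T := snd _ _; pose F : hom K (pw (prod X Y)) := fst _ _.
have Dphi := definable_and (definable_mem (fst _ _ \c t) F)
  (definable_mem (snd _ _ \c t) (xi \c (fst _ _ \c (fst _ _ \c t)))).
pose L := prod K Y.
pose tL : hom L T := t \c fst K Y.
have Dpsi := definable_ex (B := Y) (definable_and
  (definable_mem (snd K Y) (eta \c (snd _ _ \c (fst _ _ \c tL))))
  (definable_mem (pair (snd _ _ \c tL) (snd K Y)) (F \c fst K Y))).
apply: definable_iff (definable_all Dphi Dpsi) => Z G; rewrite /simulation.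
split=> H Z' u.
  move=> x y x' H1 H2.
  have := H Z' u (pair (pair x y) x'); rewrite /tL /t /F !pairE.
  move=> [] // Z'' [e [He [b]]]; rewrite !pairE => Hb.
  by exists Z'', e; split=> //; exists b.
move=> w; have [xy [x' ->]] := pairP w; have [x [y ->]] := pairP xy.
rewrite /tL /t /F !pairE => -[H1 H2].
have [Z'' [e [He [b Hb]]]] := H _ _ _ _ _ H1 H2.
by exists Z'', e; split=> //; exists b; rewrite !pairE.
Qed.

Lemma definable_bisimilar (X Y : C) (xi : hom X (pw X)) (eta : hom Y (pw Y)) :
  definable (fun Z (t : hom Z (prod X Y)) =>
    bisimilar xi eta (fst X Y \c t) (snd X Y \c t)).
Proof.
pose XY := prod X Y; pose K := prod XY (pw XY).
have D := definable_ex (B := pw XY) (definable_and (definable_and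
  (definable_pre (snd XY (pw XY)) (definable_simulation xi eta))
  (definable_pre (converse S X Y \c snd XY (pw XY)) (definable_simulation eta xi)))
  (definable_mem (fst XY (pw XY)) (snd XY (pw XY)))).
apply: definable_iff D => Z t; split=> -[Z' [e [He [F]]]].
  rewrite fst_pair -!compA snd_pair => H.
  by exists Z', e; split=> //; exists F; rewrite -!compA pair_eta.
move=> H; exists Z', e; split=> //; exists F.
by rewrite fst_pair -!compA snd_pair; rewrite -!compA pair_eta in H.
Qed.

Lemma bisimilar_comp (X Y : C) (xi : hom X (pw X)) (eta : hom Y (pw Y)) (Z Z' : C)
    (x : hom Z X) (y : hom Z Y) (u : hom Z' Z) :
  bisimilar xi eta x y -> bisimilar xi eta (x \c u) (y \c u).
Proof.
move=> H; have := definable_comp (definable_bisimilar xi eta) (f := pair x y) u.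
by rewrite fst_pair snd_pair fst_pairA snd_pairA; apply.
Qed.

Lemma bisimilar_local (X Y : C) (xi : hom X (pw X)) (eta : hom Y (pw Y)) (Z Z' : C)
    (x : hom Z X) (y : hom Z Y) (e : hom Z' Z) : cover e ->
  bisimilar xi eta (x \c e) (y \c e) -> bisimilar xi eta x y.
Proof.
move=> He H.
have := definable_local (definable_bisimilar xi eta) (f := pair x y) He.
by rewrite fst_pair snd_pair fst_pairA snd_pairA; apply.
Qed.

Lemma simulation_comp (X Y : C) (xi : hom X (pw X)) (eta : hom Y (pw Y)) (Z Z' : C)
    (F : hom Z (pw (prod X Y))) (u : hom Z' Z) :
  simulation xi eta F -> simulation xi eta (F \c u).
Proof. exact: (definable_comp (definable_simulation xi eta) u). Qed.

Lemma bisimulation_comp (X Y : C) (xi : hom X (pw X)) (eta : hom Y (pw Y)) (Z Z' : C)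
    (F : hom Z (pw (prod X Y))) (u : hom Z' Z) :
  bisimulation xi eta F -> bisimulation xi eta (F \c u).
Proof.
by move=> [H1 H2]; split; rewrite ?compA; apply: simulation_comp.
Qed.

Lemma bisimilar_sym (X Y : C) (xi : hom X (pw X)) (eta : hom Y (pw Y)) (Z : C)
    (x : hom Z X) (y : hom Z Y) :
  bisimilar xi eta x y -> bisimilar eta xi y x.
Proof.
move=> [Z' [e [He [F [[H1 H2] H]]]]]; exists Z', e; split=> //.
exists (converse S X Y \c F); rewrite mem_converse; split=> //.
by split=> //; rewrite converseK.
Qed.

Lemma bisimilar_step (X Y : C) (xi : hom X (pw X)) (eta : hom Y (pw Y)) (Z : C)
    (x : hom Z X) (y : hom Z Y) (x' : hom Z X) :
  bisimilar xi eta x y -> mem x' (xi \c x) ->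
  locally (fun Z' e => exists y' : hom Z' Y,
    mem y' (eta \c (y \c e)) /\ bisimilar xi eta (x' \c e) y').
Proof.
move=> [Z' [e [He [F [HF H]]]]] /(mem_comp e); rewrite -compA => Hx'.
rewrite -(compm1 F) in H.
apply: (locally_cover He).
have [Z'' [e' [He' [y' [Hy' H']]]]] := proj1 HF _ _ _ _ _ H Hx'.
exists Z'', e'; split=> //; exists y'.
rewrite !comp_assoc in Hy' H'; split=> //.
apply: locally_now; exists (F \c (idm Z' \c e')); split.
  exact: bisimulation_comp.
by rewrite !compm1.
Qed.

(** Phrased for any set [H] with the members of the composite, so that it applies
    to the converse of a composite as well. *)
Lemma simulation_composite (X Y W : C) (xi : hom X (pw X)) (eta : hom Y (pw Y))
    (om : hom W (pw W)) (Z : C) (F : hom Z (pw (prod X Y)))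
    (G : hom Z (pw (prod Y W))) (H : hom Z (pw (prod X W))) :
  simulation xi eta F -> simulation eta om G ->
  (forall Z' (u : hom Z' Z) x w, mem (pair x w) (H \c u) <->
    locally (fun Z'' e => exists y : hom Z'' Y,
      mem (pair (x \c e) y) (F \c (u \c e)) /\
      mem (pair y (w \c e)) (G \c (u \c e)))) ->
  simulation xi om H.
Proof.
move=> HF HG HH Z1 u x w x' /HH [Z2 [e [He [y [H1 H2]]]]] /(mem_comp e).
rewrite -compA => Hx'; apply: (locally_cover He).
have [Z3 [e3 [He3 [y' [Hy' H3]]]]] := HF _ _ _ _ _ H1 Hx'.
apply: (locally_cover He3).
have := mem_comp e3 H2; rewrite pair_comp !comp_assoc => H4.
rewrite !comp_assoc in H3.
have [Z4 [e4 [He4 [w' [Hw' H5]]]]] := HG _ _ _ _ _ H4 Hy'.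
have H6 := mem_comp e4 H3; rewrite pair_comp !comp_assoc in H6.
exists Z4, e4; split=> //; exists w'; rewrite !comp_assoc in Hw' H5 *; split=> //.
by apply/HH; apply: locally_now; exists (y' \c e4); rewrite !compm1.
Qed.

Lemma bisimilar_trans (X Y W : C) (xi : hom X (pw X)) (eta : hom Y (pw Y))
    (om : hom W (pw W)) (Z : C) (x : hom Z X) (y : hom Z Y) (w : hom Z W) :
  bisimilar xi eta x y -> bisimilar eta om y w -> bisimilar xi om x w.
Proof.
move=> [Z1 [e1 [He1 [F [HF Hxy]]]]] Hyw; apply: (bisimilar_local He1).
have [Z2 [e2 [He2 [G [HG Hyw']]]]] := bisimilar_comp e1 Hyw.
apply: (bisimilar_local He2).
have [H HH] := relation_comp (F \c e2) G.
have {}Hxy := mem_comp e2 Hxy; rewrite pair_comp in Hxy.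
apply: locally_now; exists H; split; last first.
  rewrite !compm1 -(compm1 H); apply/HH; apply: locally_now.
  by exists (y \c e1 \c e2); rewrite !compm1.
have {}HF := bisimulation_comp e2 HF.
split; first exact: simulation_composite (proj1 HF) (proj1 HG) HH.
apply: (simulation_composite (proj2 HG) (proj2 HF)) => Z' u w' x'.
rewrite -!compA mem_converse HH; split=> -[Z'' [e [He [y' H']]]];
  exists Z'', e; split=> //; exists y'; move: H';
  rewrite -!compA !mem_converse => -[]; by split.
Qed.

(** One half of [bisimilar_cospan]; passing to the converse of [F] exchanges the
    roles of [X] and [Y], which yields the other half. *)
Lemma simulation_cospan (X Y V : C) (xi : hom X (pw X)) (eta : hom Y (pw Y))
    (nu : hom V (pw V)) (f : hom X V) (g : hom Y V) (clX : hom X (pw X))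
    (clY : hom Y (pw Y)) (Z : C) (x : hom Z X) (y : hom Z Y)
    (F : hom Z (pw (prod X Y))) :
  image S f \c xi = nu \c f -> image S g \c eta = nu \c g ->
  (forall Z (a b c : hom Z X), mem b (clX \c a) -> mem c (xi \c b) -> mem c (clX \c a)) ->
  (forall Z (a b c : hom Z Y), mem b (clY \c a) -> mem c (eta \c b) -> mem c (clY \c a)) ->
  (forall Z' (u : hom Z' Z) a b, mem (pair a b) (F \c u) <->
    f \c a = g \c b /\ mem a (clX \c (x \c u)) /\ mem b (clY \c (y \c u))) ->
  simulation xi eta F.
Proof.
move=> /coalgebra_map_mem [Hf _] /coalgebra_map_mem [_ Hg] HX HY HF.
move=> Z' u a b a' /HF [E [Ha Hb]] Ha'.
have := Hf _ _ _ Ha'; rewrite E => /Hg [Z2 [e [He [b' [Hb' E']]]]].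
exists Z2, e; split=> //; exists b'; split=> //; apply/HF.
split; first by rewrite E' compA.
split; first by rewrite !compA -(compA clX); apply: mem_comp; apply: HX Ha'.
rewrite (compA y); apply: (HY _ _ (b \c e)) => //.
by rewrite compA; exact: mem_comp.
Qed.

(** The relation [f a = g b], restricted to small closed sets around [x] and [y],
    is a bisimulation; it is small because equality on [V] is. *)
Lemma bisimilar_cospan (X Y V : C) (xi : hom X (pw X)) (eta : hom Y (pw Y))
    (nu : hom V (pw V)) (f : hom X V) (g : hom Y V) (Z : C)
    (x : hom Z X) (y : hom Z Y) :
  image S f \c xi = nu \c f -> image S g \c eta = nu \c g ->
  f \c x = g \c y -> bisimilar xi eta x y.
Proof.
move=> Hf Hg E.
have [clX [clX1 clX2]] := small_closure xi.
have [clY [clY1 clY2]] := small_closure eta.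
(* The graph of [f] on one closed set, followed by the converse of that of [g]. *)
have [F HF] := relation_comp (image S (pair (idm X) f) \c (clX \c x))
  (converse S Y V \c (image S (pair (idm Y) g) \c (clY \c y))).
have {}HF Z' (u : hom Z' Z) a b : mem (pair a b) (F \c u) <->
    f \c a = g \c b /\ mem a (clX \c (x \c u)) /\ mem b (clY \c (y \c u)).
  rewrite HF; split.
    move=> [Z'' [e [He [v]]]].
    rewrite -!compA mem_converse !mem_graph => -[[H1 E1] [H2 E2]].
    split; first by apply: (cover_epi He); rewrite -!compA E1 E2.
    by split; apply: (mem_local He); rewrite -!compA.
  move=> [Eab [H1 H2]]; apply: locally_now; exists (f \c a).
  by rewrite !compm1 -!compA mem_converse !mem_graph.
apply: locally_now; exists F; split; last first.
  by rewrite -(compm1 F); apply/HF; rewrite !compm1.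
split; first exact: simulation_cospan Hf Hg clX2 clY2 HF.
apply: (simulation_cospan Hg Hf clY2 clX2 (x := y) (y := x)) => Z' u b a.
by rewrite -compA mem_converse HF; split=> -[-> [H1 H2]].
Qed.

Lemma image_idm (A : C) : image S (idm A) = idm (pw A).
Proof.
apply: mem_ext => Z u a; rewrite mem_pow_map comp1m; split.
  by move=> [Z' [e [He [b []]]]]; rewrite comp1m => H E; apply: (mem_local He);
     rewrite -E.
by move=> H; apply: locally_now; exists a; rewrite !compm1 comp1m.
Qed.

Lemma bisimilar_refl (X : C) (xi : hom X (pw X)) (Z : C) (x : hom Z X) :
  bisimilar xi xi x x.
Proof.
have E : image S (idm X) \c xi = xi \c idm X by rewrite image_idm comp1m compm1.
exact: (bisimilar_cospan E E).
Qed.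

End Bisimulation.

(** * A weakly final coalgebra *)

Section Final.
Variables (C : heyting_pretopos) (N : nno C) (S : small_maps N).

Local Notation P := (small_power S).
Local Notation pw A := (pow P A).

(** Over a cover, the fibres of a small map are isomorphic to fibres of the
    universal small map E -> U, hence embed into [E].  The embedding is recorded as
    an injective small relation [J], so that it can be used in comprehensions. *)
Lemma universal_embedding :
  exists E : C, forall (A B : C) (c : hom B (pw A)),
    exists (B' : C) (q : hom B' B) (J : hom B' (pw (prod A E))), cover q /\
      (forall Z (b : hom Z B') (a : hom Z A), mem a (c \c (q \c b)) ->
         locally (fun Z' e => exists i : hom Z' E,
           mem (pair (a \c e) i) (J \c (b \c e)))) /\
      (forall Z (b : hom Z B') (a : hom Z A) (i : hom Z E),
         mem (pair a i) (J \c b) -> mem a (c \c (q \c b))) /\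
      (forall Z (b : hom Z B') (a a' : hom Z A) (i : hom Z E),
         mem (pair a i) (J \c b) -> mem (pair a' i) (J \c b) -> a = a').
Proof.
have [E [U [univ [Huniv HU]]]] := small_universal S.
exists E => A B c.
have [M [g [h [Hg HM]]]] := mem_family c.
have [B' [q [t [Hq [k [[k' [k'k _]] Ek]]]]]] := HU _ _ g Hg.
pose j := pbl univ t \c k.
have [J HJ] := small_image (pair (h \c pbl g q) j) (small_pullback q Hg).
exists B', q, J; split; first exact: epi_cover.
split.
  move=> Z b a /HM [m [E1 E2]]; apply: locally_now.
  exists (j \c pb_pair E1); rewrite !compm1; apply/HJ; apply: locally_now.
  exists (pb_pair E1); rewrite !pairE pb_pairr pb_pairl !compm1.
  by rewrite E2.
split.
  move=> Z b a i /HJ [Z' [e [He [m []]]]]; rewrite !pairE => E1 /pair_inj [E2 _].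
  apply: (mem_local He); rewrite !comp_assoc; apply/HM.
  exists (pbl g q \c m); split=> //.
  by rewrite compA pbC comp_assoc E1.
move=> Z b a a' i /HJ [Z1 [e1 [He1 [m1 []]]]].
rewrite !pairE => E1 /pair_inj [F1 G1].
move=> /(mem_comp e1); rewrite pair_comp comp_assoc.
move=> /HJ [Z2 [e2 [He2 [m2 []]]]]; rewrite !pairE => E2 /pair_inj [F2 G2].
apply: (cover_epi (cover_comp He1 He2)).
have Em : m1 \c e2 = m2.
  rewrite -(comp1m (m1 \c e2)) -(comp1m m2) -k'k !comp_assoc; congr comp.
  apply: pb_ext.
    by rewrite G2 -(comp_assoc k) -(comp_assoc (pbl univ t)) G1 comp_assoc.
  by rewrite !compA Ek -!compA E2 compA E1 comp_assoc.
by rewrite compA -F1 !comp_assoc Em F2.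
Qed.

(** Small graphs on [E] pointed by a vertex form a coalgebra: the point moves along
    the edges, and the successors of a vertex form a set by [section_set]. *)
Lemma graph_coalgebra (E : C) :
  exists gamma : hom (prod (pw (prod E E)) E) (pw (prod (pw (prod E E)) E)),
    forall Z (T T' : hom Z (pw (prod E E))) (i i' : hom Z E),
      mem (pair T' i') (gamma \c pair T i) <-> T' = T /\ mem (pair i i') T.
Proof.
have [sec Hsec] := section_set S E E.
have [gamma Hgamma] := replacement sec
  (pair (fst _ _ \c fst (prod (pw (prod E E)) E) E) (snd _ _)).
exists gamma => Z T T' i i'; rewrite Hgamma; split.
  move=> [Z' [e [He [j []]]]]; rewrite !pairE Hsec => Hj /pair_inj [E1 E2].
  split; first by apply: esym; apply: (cover_epi He).
  by apply: (mem_local He); rewrite pair_comp -E2.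
move=> [-> H]; apply: locally_now; exists i'; rewrite !pairE !compm1.
by split=> //; apply/Hsec.
Qed.

(** A small closed set around an element can be copied into [E]; the resulting
    graph, pointed at the copy of the element, is bisimilar to it. *)
Lemma weakly_final : exists (G : C) (gamma : hom G (pw G)),
  forall (X : C) (xi : hom X (pw X)) (Z : C) (x : hom Z X),
    locally (fun Z' e => exists g : hom Z' G, bisimilar xi gamma (x \c e) g).
Proof.
have [E HE] := universal_embedding.
have [gamma Hgamma] := graph_coalgebra E.
exists _, gamma => X xi Z x.
have [cl [cl1 cl2]] := small_closure xi.
have [B [q [J [Hq [J1 [J2 J3]]]]]] := HE _ _ cl.
have [H HH] := relation_bind (converse S X E \c J) (xi \c snd B X).
(* [T b] is the graph on [E] obtained by transporting [xi] along [J b]. *)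
have [T HT] := relation_comp H J.
have {HH}HT Z' (b : hom Z' B) i i' : mem (pair i i') (T \c b) <->
    locally (fun Z'' e => exists y y' : hom Z'' X,
      mem (pair y (i \c e)) (J \c (b \c e)) /\ mem y' (xi \c y) /\
      mem (pair y' (i' \c e)) (J \c (b \c e))).
  rewrite HT; split.
    move=> [Z1 [e1 [He1 [y' [/HH [Z2 [e2 [He2 [y Hy]]]] H2]]]]].
    move: Hy; rewrite !pairE mem_converse => -[H1 H3].
    exists Z2, (e1 \c e2); split; first exact: cover_comp.
    exists y, (y' \c e2); split=> //; split=> //.
    by have := mem_comp e2 H2; rewrite !pairE.
  move=> [Z1 [e1 [He1 [y [y' [H1 [H2 H3]]]]]]]; exists Z1, e1; split=> //.
  exists y'; split=> //; apply/HH; apply: locally_now; exists y.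
  by rewrite !pairE mem_converse !compm1.
(* [F b] relates each [y] to its copy in [E], as a vertex of the graph [T b]. *)
have [F HF] := replacement J (pair (fst _ _ \c snd B (prod X E))
  (pair (T \c fst B (prod X E)) (snd _ _ \c snd B (prod X E)))).
have {}HF Z' (b : hom Z' B) y T' i :
    mem (pair y (pair T' i)) (F \c b) <-> T' = T \c b /\ mem (pair y i) (J \c b).
  rewrite HF; split.
    move=> [Z1 [e1 [He1 [t [Ht]]]]]; rewrite !pairE.
    move=> /pair_inj [E1 /pair_inj [E2 E3]]; split.
      by apply: esym; apply: (cover_epi He1); rewrite comp_assoc.
    by apply: (mem_local He1); rewrite pair_comp -E1 -E3 pair_eta comp_assoc.
  move=> [-> Hy]; apply: locally_now; exists (pair y i).
  by rewrite !pairE !compm1.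
have HB : bisimulation xi gamma F.
  split=> Z' u.
    move=> y g y'; have [T' [i ->]] := pairP g => /HF [ET Hy] Hy'.
    have [Z1 [e1 [He1 [i' Hi']]]] : locally (fun Z1 e => exists i' : hom Z1 E,
        mem (pair (y' \c e) i') (J \c (u \c e))).
      by apply: J1; apply: cl2 Hy'; apply: J2 Hy.
    exists Z1, e1; split=> //; exists (pair (T' \c e1) i'); split.
      rewrite pair_comp; apply/Hgamma; split=> //.
      rewrite ET comp_assoc; apply/HT; apply: locally_now.
      exists (y \c e1), (y' \c e1); rewrite !compm1; split.
        by have := mem_comp e1 Hy; rewrite !pairE.
      by split=> //; rewrite compA; apply: mem_comp.
    by apply/HF; rewrite ET comp_assoc.
  move=> g y g'; rewrite comp_assoc mem_converse.
  have [T' [i ->]] := pairP g; have [T'' [i' ->]] := pairP g'.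
  move=> /HF [ET Hy] /Hgamma [ET']; rewrite ET.
  move=> /HT [Z1 [e1 [He1 [y1 [y1' [H1 [H2 H3]]]]]]].
  have Hye := mem_comp e1 Hy; rewrite !pairE in Hye.
  have Ey : y1 = y \c e1 := J3 _ _ _ _ _ H1 Hye.
  exists Z1, e1; split=> //; exists y1'; rewrite -Ey; split=> //.
  rewrite comp_assoc mem_converse pair_comp; apply/HF.
  by rewrite ET' ET comp_assoc.
have [Z1 [e1 [He1 [i Hi]]]] : locally (fun Z1 e => exists i : hom Z1 E,
    mem (pair (q \c pbl q x \c e) i) (J \c (pbl q x \c e))).
  exact: J1.
exists Z1, (pbr q x \c e1); split.
  by apply: cover_comp => //; exact: cover_pbr.
exists (pair (T \c (pbl q x \c e1)) i); apply: locally_now.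
exists (F \c (pbl q x \c e1 \c idm Z1)); split; first exact: bisimulation_comp.
rewrite compA -pbC !compm1; by apply/HF.
Qed.

(** * The final coalgebra *)

Lemma bisimilarity_equivalence (X R : C) (xi : hom X (pw X))
    (r : hom R (prod X X)) : mono r ->
  (forall Z (x y : hom Z X), bisimilar xi xi x y <-> factors (pair x y) r) ->
  equivalence_relation (fst X X \c r) (snd X X \c r).
Proof.
move=> Hm Hr.
have Hgen : bisimilar xi xi (fst X X \c r) (snd X X \c r).
  by apply/Hr; exists (idm R); rewrite pair_eta compm1.
split; first by rewrite pair_eta.
split.
  have [d Hd] := proj1 (Hr _ _ _) (bisimilar_refl xi (idm X)).
  by exists d; rewrite !comp_assoc Hd !pairE.
split.
  have [d Hd] := proj1 (Hr _ _ _) (bisimilar_sym Hgen).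
  by exists d; rewrite !comp_assoc Hd !pairE.
set r1 := fst X X \c r in Hgen *; set r2 := snd X X \c r in Hgen *.
have H1 := bisimilar_comp (pbl r2 r1) Hgen.
have H2 := bisimilar_comp (pbr r2 r1) Hgen.
rewrite -pbC in H2.
have [d Hd] := proj1 (Hr _ _ _) (bisimilar_trans H1 H2).
by exists d; split; rewrite (comp_assoc _ r) Hd !pairE.
Qed.

Lemma cover_locally (A B Z : C) (q : hom A B) (b : hom Z B) : cover q ->
  locally (fun Z' e => exists a : hom Z' A, q \c a = b \c e).
Proof.
move=> Hq; exists _, (pbr q b); split; first exact: cover_pbr.
by exists (pbl q b); exact: pbC.
Qed.

(** The map provided by effectiveness has the right kernel pair; its image part
    has the same one and is a cover. *)
Lemma bisimilarity_quotient (X : C) (xi : hom X (pw X)) :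
  exists (V : C) (q : hom X V), cover q /\
    forall Z (x y : hom Z X), q \c x = q \c y <-> bisimilar xi xi x y.
Proof.
have [R [r [Hm Hr]]] := definable_bisimilar xi xi.
have Hr' Z (x y : hom Z X) : bisimilar xi xi x y <-> factors (pair x y) r.
  by rewrite -Hr !pairE.
have [Q [q [E Hq]]] := effective (bisimilarity_equivalence Hm Hr').
exists _, (im_cover q); split; first exact: im_coverP.
move=> Z x y; rewrite Hr'; split.
  move=> /(f_equal (fun t => im_mono q \c t)); rewrite /= !compA im_fact => Exy.
  have [w [[<- <-] _]] := Hq _ _ _ Exy.
  by exists w; rewrite !comp_assoc pair_eta.
move=> [h Hh]; apply: (@im_monoP _ _ _ q); rewrite !compA im_fact.
have := f_equal (fun t => t \c h) E; rewrite /= !comp_assoc Hh !pairE.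
by [].
Qed.

(** The class of [x] has as members the classes of the members of [x]; another
    representative gives the same ones, because the members of bisimilar elements
    match up to bisimilarity. *)
Lemma quotient_coalgebra (X V : C) (xi : hom X (pw X)) (q : hom X V) : cover q ->
  (forall Z (x y : hom Z X), q \c x = q \c y <-> bisimilar xi xi x y) ->
  exists nu : hom V (pw V), image S q \c xi = nu \c q.
Proof.
move=> Hq Hbis.
have Himg Z (x y : hom Z X) : q \c x = q \c y ->
    image S q \c (xi \c x) = image S q \c (xi \c y).
  suff H Z' (x' y' : hom Z' X) (v : hom Z' V) : bisimilar xi xi x' y' ->
      mem v (image S q \c (xi \c x')) -> mem v (image S q \c (xi \c y')).
    move=> /Hbis E; apply: mem_ext => Z' u v; rewrite !comp_assoc.
    split; apply: H; first exact: bisimilar_comp.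
    exact: (bisimilar_comp u (bisimilar_sym E)).
  move=> Hxy /mem_pow_map [Z1 [e1 [He1 [a [Ha Eav]]]]].
  rewrite comp_assoc in Ha.
  have [Z2 [e2 [He2 [b [Hb Hab]]]]] := bisimilar_step (bisimilar_comp e1 Hxy) Ha.
  apply: (mem_local (cover_comp He1 He2)); rewrite comp_assoc; apply/mem_pow_map.
  apply: locally_now; exists b; rewrite !compm1 (compA v) -Eav !comp_assoc.
  by rewrite comp_assoc in Hb; split=> //; apply: esym; apply/Hbis.
pose phi Z (v : hom Z V) (s : hom Z (pw V)) := locally (fun Z' e =>
  exists x : hom Z' X, q \c x = v \c e /\ image S q \c (xi \c x) = s \c e).
have Dphi : definable (fun Z (t : hom Z (prod V (pw V))) =>
    phi Z (fst V (pw V) \c t) (snd V (pw V) \c t)).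
  pose K := prod V (pw V).
  have D := definable_ex (B := X) (definable_and
    (definable_eq (q \c snd K X) (fst V (pw V) \c fst K X))
    (definable_eq (image S q \c (xi \c snd K X)) (snd V (pw V) \c fst K X))).
  apply: definable_iff D => Z t.
  split=> -[Z' [e [He [x Hx]]]]; exists Z', e; split=> //; exists x; move: Hx;
    by rewrite !pairE.
have [nu Hnu] : exists nu : hom V (pw V), forall Z (v : hom Z V), phi Z v (nu \c v).
  apply: (unique_choice Dphi) => Z v.
    have [Z' [e [He [x Hx]]]] := cover_locally v Hq.
    exists Z', e; split=> //; exists (image S q \c (xi \c x)).
    by apply: locally_now; exists x; rewrite !compm1.
  move=> s s' [Z1 [e1 [He1 [x [Hx Ex]]]]] [Z2 [e2 [He2 [y [Hy Ey]]]]].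
  (* Compare the two witnesses on the pullback of the two covers. *)
  have Hc := cover_comp He1 (cover_pbr (f := e1) He2).
  apply: (cover_epi Hc).
  rewrite -[in RHS]pbC (compA s) (compA s') -Ex -Ey !comp_assoc.
  by apply: Himg; rewrite !compA Hx Hy !comp_assoc pbC.
exists nu; have [Z [e [He [x [Hx Ex]]]]] := Hnu _ q.
by apply: (cover_epi He); rewrite comp_assoc -Ex; apply: Himg.
Qed.

(** Bisimilarity to an element of a weakly final [G] is a functional relation from
    any coalgebra to the quotient of [G]. *)
Lemma final_coalgebra : exists (V : C) (nu : hom V (pw V)),
  forall (X : C) (xi : hom X (pw X)),
    exists! f : hom X V, image S f \c xi = nu \c f.
Proof.
have [G [gamma HG]] := weakly_final.
have [V [q [Hq Hbis]]] := bisimilarity_quotient gamma.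
have [nu Hnu] := quotient_coalgebra Hq Hbis.
exists V, nu => X xi.
pose phi Z (x : hom Z X) (v : hom Z V) := locally (fun Z' e =>
  exists g : hom Z' G, bisimilar xi gamma (x \c e) g /\ q \c g = v \c e).
have Huniq Z (x : hom Z X) (v : hom Z V) (g : hom Z G) :
    phi Z x v -> bisimilar xi gamma x g -> v = q \c g.
  move=> [Z1 [e1 [He1 [g1 [H1 E1]]]]] H; apply: (cover_epi He1).
  rewrite -E1 comp_assoc; apply/Hbis.
  exact: (bisimilar_trans (bisimilar_sym H1) (bisimilar_comp e1 H)).
have Dphi : definable (fun Z (t : hom Z (prod X V)) =>
    phi Z (fst X V \c t) (snd X V \c t)).
  pose K := prod X V.
  have D := definable_ex (B := G) (definable_and
    (definable_pre (pair (fst X V \c fst K G) (snd K G))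
                   (definable_bisimilar xi gamma))
    (definable_eq (q \c snd K G) (snd X V \c fst K G))).
  apply: definable_iff D => Z t.
  split=> -[Z' [e [He [g Hg]]]]; exists Z', e; split=> //; exists g; move: Hg;
    by rewrite !pairE.
have [f Hf] : exists f : hom X V, forall Z (x : hom Z X), phi Z x (f \c x).
  apply: (unique_choice Dphi) => Z x.
    have [Z' [e [He [g Hg]]]] := HG _ xi _ x.
    exists Z', e; split=> //; exists (q \c g); apply: locally_now; exists g.
    by rewrite !compm1.
  move=> v v' H [Z1 [e1 [He1 [g [Hg E]]]]]; apply: (cover_epi He1).
  rewrite -E; apply: (Huniq _ (x \c e1)) => //.
  have := definable_comp Dphi (f := pair x v) e1; rewrite !pairE; exact.
have Hfq Z (x : hom Z X) (g : hom Z G) : bisimilar xi gamma x g -> f \c x = q \c g.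
  exact: Huniq.
exists f; split.
  apply/coalgebra_map_mem; split=> Z x.
    move=> x' /mem_comp Hx'; have [Z1 [e1 [He1 [g Hg]]]] := HG _ xi _ x.
    have := Hx' _ e1; rewrite comp_assoc => /(bisimilar_step Hg).
    move=> [Z2 [e2 [He2 [g' [Hg' Hb]]]]].
    apply: (mem_local (cover_comp He1 He2)).
    rewrite !comp_assoc -(comp_assoc x') (Hfq _ _ _ Hb).
    rewrite -(comp_assoc x) -(comp_assoc f) (Hfq _ _ _ Hg) comp_assoc (compA nu).
    rewrite -Hnu comp_assoc; apply/mem_pow_map; apply: locally_now.
    by exists g'; rewrite !compm1.
  move=> v Hv; have [Z1 [e1 [He1 [g Hg]]]] := HG _ xi _ x.
  apply: (locally_cover He1).
  have := mem_comp e1 Hv; rewrite !comp_assoc (Hfq _ _ _ Hg) (compA nu) -Hnu.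
  rewrite comp_assoc => /mem_pow_map [Z2 [e2 [He2 [g' [Hg' E]]]]].
  apply: (locally_cover He2); rewrite comp_assoc in Hg'.
  have [Z3 [e3 [He3 [x' [Hx' Hb]]]]] :=
    bisimilar_step (bisimilar_comp e2 (bisimilar_sym Hg)) Hg'.
  exists Z3, e3; split=> //; exists x'; rewrite !comp_assoc in Hx'; split=> //.
  by rewrite (Hfq _ _ _ (bisimilar_sym Hb)) compA E !comp_assoc.
move=> f' Hf'; have [Z [e [He [g Hg]]]] := cover_locally f' Hq.
by apply: (cover_epi He); rewrite -Hg; apply: Hfq;
   apply: (bisimilar_cospan Hf' Hnu).
Qed.

End Final.

(** * Coalgebras in the slices *)

Section Slices.
Variables (C : heyting_pretopos) (N : nno C) (S : small_maps N) (I : C).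

Local Notation P := (small_power S).
Local Notation PI := (power_at S I).
Local Notation st := (@small_stable _ _ S).
Local Notation qI := (slice_quotient (I := I) (@small_quotient _ _ S)).

(** Products in the slice are fibre products over [I]; this is their inclusion
    into the products of [C]. *)
Definition split_prod (Y X : slice C I) :
  hom (dom (prod Y X)) (prod (dom Y) (dom X)) :=
  pair (over (fst Y X)) (over (snd Y X)).

Lemma down_rel_split (Y X : slice C I) (R : small_rel (slice_class S I) Y X) :
  rel_map (down_rel R) = split_prod Y X \c over (rel_map R).
Proof. by rewrite /split_prod pair_comp. Qed.

Lemma split_prodmap (Y X W : slice C I) (f : hom X W) :
  split_prod Y W \c over (prodmap (idm Y) f) =
  prodmap (idm (dom Y)) (over f) \c split_prod Y X.
Proof.
rewrite /split_prod prodmap_pair pair_comp comp1m; congr pair.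
  rewrite -[LHS]/(over (fst Y W \c prodmap (idm Y) f)) fst_prodmap.
  by rewrite comp1m.
by rewrite -[LHS]/(over (snd Y W \c prodmap (idm Y) f)) snd_prodmap.
Qed.

Lemma factors_down_rel_im (Y X W : slice C I) (f : hom X W)
    (R : small_rel (slice_class S I) Y X) (Z : C)
    (t : hom Z (prod (dom Y) (dom W))) :
  factors t (rel_map (down_rel (rel_im qI f R))) <->
  locally (fun Z' e => exists m : hom Z' (dom (rel_ob R)),
    prodmap (idm (dom Y)) (over f) \c (rel_map (down_rel R) \c m) = t \c e).
Proof.
have Eh Z' (m : hom Z' (dom (rel_ob R))) :
    split_prod Y W \c (over (rel_imap f R) \c m) =
    prodmap (idm (dom Y)) (over f) \c (rel_map (down_rel R) \c m).
  rewrite down_rel_split.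
  rewrite -[over (rel_imap f R)]/(over (prodmap (idm Y) f) \c over (rel_map R)).
  by rewrite !compA split_prodmap.
rewrite down_rel_split; split.
  move=> [k Hk].
  have [Z' [e [He [m Hm]]]] := proj1 (factors_im (over (rel_imap f R))
    (im_mono (over (rel_imap f R)) \c k)) (ex_intro _ k (erefl _)).
  exists Z', e; split=> //; exists m.
  by rewrite -Eh Hm -Hk !comp_assoc.
move=> [Z' [e [He [m Hm]]]]; rewrite -down_rel_split.
apply: (factors_local (@rel_mono _ _ _ _ (down_rel _)) He).
exists (im_cover (over (rel_imap f R)) \c m).
rewrite -Hm -Eh down_rel_split comp_assoc; congr comp.
by rewrite compA; congr comp; exact: im_fact.
Qed.

(** A coalgebra over [I] is an ordinary coalgebra on the total object, since the
    fibrewise powerclass is a subobject of the constant one. *)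
Definition total (Y X : slice C I) (c : hom Y (slice_pow P X)) :
    hom (dom Y) (pow P (dom X)) :=
  snd I (pow P (dom X)) \c (fibre_incl P X \c over c).

Lemma total_inj (Y X : slice C I) (c d : hom Y (slice_pow P X)) :
  total c = total d -> c = d.
Proof.
move=> E; apply: over_inj; apply: (fibre_mono (X := X)).
apply: prod_ext; last exact: E.
have F (b : hom Y (slice_pow P X)) :
    fst I (pow P (dom X)) \c (fibre_incl P X \c over b) = arr Y.
  by rewrite -(overP b) /= compA.
by rewrite !F.
Qed.

Lemma mem_total_over (Y X : slice C I) (c : hom Y (slice_pow P X)) (Z : C)
    (y : hom Z (dom Y)) (x : hom Z (dom X)) :
  mem x (total c \c y) -> arr X \c x = arr Y \c y.
Proof.
have E : arr X \c (snd _ _ \c rel_map (rel_of (total c))) =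
    arr Y \c (fst _ _ \c rel_map (rel_of (total c))) := slice_rel_ofP st c.
move=> /mem_rel_of [h Hh].
have := f_equal (fun t => t \c h) E.
by rewrite /= !comp_assoc Hh fst_pair snd_pair => ->.
Qed.

Lemma total_classify (Y X : slice C I) (R : small_rel (slice_class S I) Y X) :
  total (classify PI R) = classify P (down_rel R).
Proof. by rewrite /total slice_classify0E snd_pair. Qed.

Lemma factors_mem_rel (X : slice C I) (Z : C) (s : hom Z (dom (slice_pow P X)))
    (x : hom Z (dom X)) :
  factors (pair s x) (rel_map (down_rel (mem_rel PI X))) <->
  mem x (snd I (pow P (dom X)) \c (fibre_incl P X \c s)).
Proof.
have [F F'] := down_up (slice_rel_ofP st (idm (slice_pow P X))).
have Em : mem x (snd I (pow P (dom X)) \c (fibre_incl P X \c s)) <->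
    factors (pair s x) (rel_map (rel_of (total (idm (slice_pow P X))))).
  rewrite -mem_rel_of /total.
  have -> : over (idm (slice_pow P X)) = idm (dom (slice_pow P X)) by [].
  by rewrite compm1 !comp_assoc.
rewrite Em; split=> H; first exact: factors_trans H F.
exact: factors_trans H F'.
Qed.

Lemma total_comp (Y Y' X : slice C I) (c : hom Y (slice_pow P X)) (g : hom Y' Y) :
  total (c \c g) = total c \c over g.
Proof. by rewrite /total -[over (c \c g)]/(over c \c over g) !compA. Qed.

Lemma mem_pow_map_total (Y X W : slice C I) (f : hom X W)
    (c : hom Y (slice_pow P X)) (Z : C) (y : hom Z (dom Y)) (w : hom Z (dom W)) :
  mem w (total (pow_map qI PI f \c c) \c y) <->
  locally (fun Z' e => exists x : hom Z' (dom X),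
    mem x (total c \c (y \c e)) /\ over f \c x = w \c e).
Proof.
rewrite total_comp total_classify comp_assoc mem_classify factors_down_rel_im.
split=> -[Z' [e [He]]].
  move=> [m]; rewrite -(pair_eta (rel_map (down_rel (mem_rel PI X)) \c m)).
  rewrite prodmap_pair comp1m pair_comp.
  move=> /pair_inj [E1 E2]; exists Z', e; split=> //.
  exists (snd _ _ \c (rel_map (down_rel (mem_rel PI X)) \c m)); split=> //.
  rewrite /total !comp_assoc; apply/factors_mem_rel; exists m.
  by rewrite -comp_assoc -E1 pair_eta.
move=> [x [Hx E]]; exists Z', e; split=> //.
move: Hx; rewrite /total !comp_assoc => /factors_mem_rel [m Hm].
by exists m; rewrite Hm prodmap_pair comp1m pair_comp E comp_assoc.
Qed.

Lemma mem_star_pow (A Z : C) (i j : hom Z I) (c : hom Z (pow P A)) (a : hom Z A) :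
  mem (pair i a) (total (star_pow S I A) \c pair j c) <-> i = j /\ mem a c.
Proof.
rewrite total_classify mem_classify.
set R := mem_rel P A.
have -> : rel_map (down_rel (star_rel I st R)) =
    pair (prodmap (idm I) (fst _ _ \c rel_map R))
         (prodmap (idm I) (snd _ _ \c rel_map R)).
  pose r1 := star_map I (fst (pow P A) A \c rel_map R).
  pose r2 := star_map I (snd (pow P A) A \c rel_map R).
  exact: (f_equal2 (fun f g => pair (over f) (over g))
    (fst_pair (C := slice C I) r1 r2) (snd_pair (C := slice C I) r1 r2)).
split.
  move=> [h]; have [k [m ->]] := pairP h.
  rewrite pair_comp !prodmap_pair !comp1m => /pair_inj [].
  move=> /pair_inj [-> E1] /pair_inj [-> E2]; split=> //.
  by exists m; rewrite -E1 -E2 !comp_assoc pair_eta.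
move=> [-> [m Hm]]; exists (pair j m).
by rewrite pair_comp !prodmap_pair !comp1m !comp_assoc Hm fst_pair snd_pair.
Qed.

(** On both sides the equation says that the members of [f x] are the images of
    the members of [x].  The components in [I] agree automatically, as the members
    of [x] lie in the fibre of [x]. *)
Lemma slice_coalgebra_map (V : power_coalgebra S) (X : coalgebra PI)
    (phi : hom (carrier X) (star I (carrier V))) (f : hom (dom (carrier X)) (carrier V)) :
  over phi = pair (arr (carrier X)) f ->
  (coalgebra_map qI (X := X) (Y := star_coalgebra I V) phi <->
   image S f \c total (structure X) = structure V \c f).
Proof.
case: X phi f => X xi phi f; case: V phi f => V nu phi f /= Ephi.
rewrite /coalgebra_map.
have HR Z (x : hom Z (dom X)) (i : hom Z I) (v : hom Z V) :
    mem (pair i v) (total (star_pow S I V \c star_map I nu \c phi) \c x) <->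
    i = arr X \c x /\ mem v (nu \c (f \c x)).
  have Es : over (star_map I nu) = prodmap (idm I) nu by [].
  have Ex : prodmap (idm I) nu \c (pair (arr X) f \c x) =
      pair (arr X \c x) (nu \c (f \c x)).
    by rewrite [pair _ _ \c x]pair_comp prodmap_pair comp1m.
  rewrite !total_comp Ephi Es -(compA _ (pair _ _) x) -(compA _ (prodmap _ _)) Ex.
  exact: mem_star_pow.
have HL Z (x : hom Z (dom X)) (i : hom Z I) (v : hom Z V) :
    mem (pair i v) (total (pow_map qI PI phi \c xi) \c x) <->
    i = arr X \c x /\ mem v (image S f \c (total xi \c x)).
  rewrite (mem_pow_map_total phi xi) mem_pow_map Ephi; split.
    move=> [Z' [e [He [y [Hy]]]]]; rewrite !pair_comp => /pair_inj [E1 E2].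
    split; last by exists Z', e; split=> //; exists y; rewrite comp_assoc.
    by apply: (cover_epi He); rewrite -E1 (mem_total_over Hy) comp_assoc.
  move=> [-> [Z' [e [He [y [Hy E]]]]]]; rewrite comp_assoc in Hy.
  exists Z', e; split=> //; exists y; split=> //.
  by rewrite !pair_comp E (mem_total_over Hy) comp_assoc.
split=> E.
  apply: mem_ext => Z x v; rewrite -(compA (image S f)) -(compA nu).
  have L := HL Z x (arr X \c x) v; have R := HR Z x (arr X \c x) v.
  rewrite E in L.
  split=> H.
    by have [] := proj1 R (proj2 L (conj (erefl _) H)).
  by have [] := proj1 L (proj2 R (conj (erefl _) H)).
apply: total_inj; apply: mem_ext => Z x w; have [i [v ->]] := pairP w.
by rewrite HL HR compA E comp_assoc.
Qed.

End Slices.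

Lemma final_in_slices (C : heyting_pretopos) (N : nno C) (S : small_maps N)
    (V : power_coalgebra S) :
  (forall (X : C) (xi : hom X (pow (small_power S) X)),
     exists! f : hom X (carrier V), image S f \c xi = structure V \c f) ->
  indexed_final_coalgebra V.
Proof.
move=> HV I X; have [f [Hf Huniq]] := HV _ (total (structure X)).
have Hphi : arr (star I (carrier V)) \c pair (arr (carrier X)) f = arr (carrier X).
  exact: fst_pair.
exists (@SliceHom _ _ (carrier X) (star I (carrier V)) _ Hphi); split.
  by apply/(slice_coalgebra_map _ (f := f)).
move=> psi Hpsi; apply: over_inj => /=.
have E : over psi = pair (arr (carrier X)) (snd _ _ \c over psi).
  by rewrite -{1}(overP psi) /= pair_eta.
rewrite E; congr pair; apply: Huniq.
exact: (proj1 (slice_coalgebra_map E) Hpsi).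
Qed.

Theorem theorem3p7 (C : heyting_pretopos) (N : nno C) (S : small_maps N) :
  exists V : power_coalgebra S, indexed_final_coalgebra V.
Proof.
have [V [nu H]] := final_coalgebra S.
by exists (Coalgebra nu); exact: final_in_slices.
Qed.
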